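(* For $k\ge 1$ let $\bar{\mathcal G}_k$ be the conjugate of the $k$-th coefficient of the generating function $\mathcal G$, where $\overline{\mathcal G(z)}=f'(z)\bar\psi(z)$ for $z\in S^1$ and $\mathcal G(z)=\sum_{k\in\mathbb Z}\mathcal G_kz^{k-1}$; explicitly, $$\bar{\mathcal G}_k=\bar\psi_k+\sum_{j=1}^\infty (j+1)c_j\bar\psi_{k+j}.$$ Then, with respect to the canonical Poisson structure, the Witt commutation relations $$\{\bar{\mathcal G}_m,\bar{\mathcal G}_n\}=(n-m)\,\bar{\mathcal G}_{n+m}$$ hold for all $n,m\ge 1$.
   Context: $f(z)=z\bigl(1+\sum_{n\ge1}c_nz^n\bigr)$ is a univalent function in the unit disk, smooth on the closed disk and injective on $S^1$, and $\psi(z)=\sum_{k\in\mathbb Z}\psi_kz^{k-1}$ is a smooth function on $S^1$ with conjugate $\bar\psi$. The numbers $c_n$ ($n\ge1$) and $\bar\psi_m$ ($m\in\mathbb Z$) are regarded as the coordinates on phase space. The Poisson bracket is the canonical one, i.e. the bilinear, antisymmetric bracket satisfying the Leibniz rule, with $$\{c_n,\bar\psi_m\}=\delta_{n,m},\qquad \{c_n,c_k\}=0,\qquad \{\bar\psi_l,\bar\psi_m\}=0,$$ so that $\{R_1,R_2\}=\sum_{k\ge1}\Bigl(\frac{\partial R_1}{\partial c_k}\frac{\partial R_2}{\partial\bar\psi_k}-\frac{\partial R_1}{\partial\bar\psi_k}\frac{\partial R_2}{\partial c_k}\Bigr)$. *)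

(* Defs.v *)
(* Stdlib reals with Coquelicot *)
From Stdlib Require Export Reals ZArith.
From Coquelicot Require Export Coquelicot.
Open Scope C_scope.

Definition is_Cseries (u : nat -> C) (s : C) : Prop :=
  @is_series C_AbsRing C_NormedModule u s.

(* Like [RInt] for [is_RInt]: a total operator, meaningful on convergent series. *)
Definition CSeries (u : nat -> C) : C :=
  @iota C_CompleteNormedModule (is_Cseries u).

Definition CpowZ (z : C) (k : Z) : C :=
  match k with
  | Z0 => 1
  | Zpos p => z ^ Pos.to_nat p
  | Zneg p => / z ^ Pos.to_nat p
  end.

Definition abs_summableZ (a : Z -> C) : Prop :=
  ex_series (fun n => Cmod (a (Z.of_nat n))) /\
  ex_series (fun n => Cmod (a (- Z.of_nat (S n))%Z)).

Definition CSeriesZ (a : Z -> C) : C :=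
  CSeries (fun n => a (Z.of_nat n)) + CSeries (fun n => a (- Z.of_nat (S n))%Z).

Definition open_disk (z : C) : Prop := (Cmod z < 1)%R.
Definition closed_disk (z : C) : Prop := (Cmod z <= 1)%R.
Definition circle (z : C) : Prop := Cmod z = 1%R.

(* Complex derivative at [z], with increments restricted to the closed disk: it
   is the usual one for |z| < 1, and the boundary value of f' for |z| = 1. *)
Definition is_disk_derive (f : C -> C) (z l : C) : Prop :=
  @filterdiff C_AbsRing (AbsRing_NormedModule C_AbsRing) C_NormedModule
    f (within closed_disk (@locally (AbsRing_UniformSpace C_AbsRing) z))
    (fun h : C => h * l).

Definition disk_derive (f : C -> C) (z : C) : C :=
  @iota C_CompleteNormedModule (is_disk_derive f z).

Definition smooth_on_closed_disk (f : C -> C) : Prop :=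
  exists D : nat -> C -> C,
    (forall z, closed_disk z -> D O z = f z) /\
    (forall n z, closed_disk z -> is_disk_derive (D n) z (D (S n) z)).

Definition injective_on (A : C -> Prop) (f : C -> C) : Prop :=
  forall z w, A z -> A w -> f z = f w -> z = w.

Definition univalent (f : C -> C) : Prop :=
  (forall z, open_disk z -> @ex_derive C_AbsRing C_NormedModule f z) /\
  injective_on open_disk f.

Definition smooth_on_circle (h : C -> C) : Prop :=
  forall (n : nat) (t : R),
    ex_derive_n (fun s : R => Re (h (cos s, sin s))) n t /\
    ex_derive_n (fun s : R => Im (h (cos s, sin s))) n t.

(* h(z) = sum_k a_k z^(k-1) on the circle, with the shifted exponent used for
   vector fields.  The expansion of a smooth function converges absolutely. *)
Definition laurent_expansion (h : C -> C) (a : Z -> C) : Prop :=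
  abs_summableZ a /\
  forall z, circle z -> h z = CSeriesZ (fun k => a k * CpowZ z (k - 1)).

Definition laurent_coef (h : C -> C) (k : Z) : C :=
  @iota C_CompleteNormedModule
    (fun l : C => exists a, laurent_expansion h a /\ l = a k).

(* The coordinates are c_n for n >= 1 (the slot [c x 0] is never read) and the
   conjugates [psib x m] of the coefficients psi_m, treated as independent of
   their own conjugates. *)
Record coords := Coords { c : nat -> C; psib : Z -> C }.

Definition f_of (x : coords) (z : C) : C :=
  z * (1 + CSeries (fun i => c x (S i) * z ^ S i)).

Definition psi_of (x : coords) (z : C) : C :=
  CSeriesZ (fun k => Cconj (psib x k) * CpowZ z (k - 1)).

Record phase_space (x : coords) : Prop := {
  f_converges : forall z, open_disk z ->
    exists s, is_Cseries (fun i => c x (S i) * z ^ S i) s;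
  f_univalent : univalent (f_of x);
  f_smooth : smooth_on_closed_disk (f_of x);
  f_injective : injective_on circle (f_of x);
  psi_expansion : laurent_expansion (psi_of x) (fun k => Cconj (psib x k));
  psi_smooth : smooth_on_circle (psi_of x)
}.

Definition set_c (x : coords) (k : nat) (t : C) : coords :=
  Coords (fun n => if Nat.eqb n k then t else c x n) (psib x).

Definition set_psib (x : coords) (k : Z) (t : C) : coords :=
  Coords (c x) (fun m => if Z.eqb m k then t else psib x m).

Definition is_partial_c (F : coords -> C) (k : nat) (x : coords) (l : C) : Prop :=
  @is_derive C_AbsRing C_NormedModule (fun t : C => F (set_c x k t)) (c x k) l.

Definition is_partial_psib (F : coords -> C) (k : Z) (x : coords) (l : C) : Prop :=
  @is_derive C_AbsRing C_NormedModule
    (fun t : C => F (set_psib x k t)) (psib x k) l.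

(* {F1, F2} exists at x and equals v: all the partial derivatives involved
   exist, and the series over k >= 1 converges to v. *)
Definition is_poisson_bracket (F1 F2 : coords -> C) (x : coords) (v : C) : Prop :=
  exists dc1 dp1 dc2 dp2 : nat -> C,
    (forall k : nat, (1 <= k)%nat ->
       is_partial_c F1 k x (dc1 k) /\ is_partial_psib F1 (Z.of_nat k) x (dp1 k) /\
       is_partial_c F2 k x (dc2 k) /\ is_partial_psib F2 (Z.of_nat k) x (dp2 k)) /\
    is_Cseries (fun i => dc1 (S i) * dp2 (S i) - dp1 (S i) * dc2 (S i)) v.

(* Only the values on the circle matter. *)
Definition gen_G (x : coords) (z : C) : C :=
  Cconj (disk_derive (f_of x) z * Cconj (psi_of x z)).

Definition G (k : Z) (x : coords) : C := laurent_coef (gen_G x) k.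

Definition Gbar (k : Z) (x : coords) : C := Cconj (G k x).

(* Main.v *)
(** Write [a_0 = 1] and [a_j = (j+1) c_j], the Taylor coefficients of [f'].  On the
    circle [f'(z) psibar(z)] is the product of two absolutely convergent Laurent series,
    so [Gbar_k = sum_(j >= 0) a_j psibar_(k+j)], which is affine in every single
    coordinate: [d Gbar_m / d c_k = (k+1) psibar_(m+k)] and
    [d Gbar_m / d psibar_k = a_(k-m)], or [0] if [k < m].  With [k = j+n], respectively
    [k = j+m], both halves of [{Gbar_m, Gbar_n}] become series in
    [a_j psibar_(n+m+j)], with factors [j+n+1] and [j+m+1] whose difference is [n-m].

    Convergence of each half needs [(j+1) a_j] bounded.  Smoothness up to the boundary
    makes the third derivative of [f] bounded on the closed disk, and Cauchy's estimate on the circles of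
    radius [r < 1] then gives [c_j = O(j^-3)].  Cauchy's estimate for absolutely
    convergent Laurent series, which also yields uniqueness of the expansion, is obtained
    without integrals by averaging truncations over roots of unity. *)

From Stdlib Require Import Lra Lia List Classical IndefiniteDescription FunctionalExtensionality.
Require Import Defs.

(** * Absolutely convergent complex series *)

(** [G] and [disk_derive] are definite-description operators, so nothing can be computed with [Gbar]
    before the Laurent expansion of [gen_G] is known to exist and to be unique. This must hold not
    only at [x]: a partial derivative evaluates [Gbar] at points that differ from [x] in one
    coordinate, and such points may leave the phase space, since changing a single [c_k] can destroy
    univalence. The closed formula for [Gbar] is therefore proved under the condition [regular],
    absolute summability of [a_j] and of [psibar_k], which survives such changes and suffices to
    differentiate [f] up to the circle. The third derivative enters because it bounds [(j+1)^2 a_j];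
    this gives both the summability of [a_j] and the boundedness of [(j+1) a_j]. Radii [r < 1] are
    used because the power series of that derivative is known to represent it only inside the disk;
    the resulting bound does not depend on [r], so [r] can tend to [1]. *)

Definition abs_summable (u : nat -> C) : Prop := ex_series (fun n => Cmod (u n)).

Lemma is_Cseries_unique (u : nat -> C) (s : C) : is_Cseries u s -> CSeries u = s.
Proof.
  intros H. apply (@iota_unique C_AbsRing C_CompleteNormedModule); [|exact H].
  intros y Hy.
  exact (@filterlim_locally_unique nat C_AbsRing C_NormedModule eventually _
           (sum_n u) y s Hy H).
Qed.

Lemma abs_summable_series (u : nat -> C) :
  abs_summable u -> is_Cseries u (CSeries u).
Proof.
  intros H.
  destruct (@ex_series_le C_AbsRing C_CompleteNormedModule u (fun n => Cmod (u n)))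
    as [s Hs]; [intros n; apply Rle_refl | exact H |].
  rewrite (is_Cseries_unique u s Hs). exact Hs.
Qed.

Lemma is_Cseries_ext (u v : nat -> C) (s : C) :
  (forall n, u n = v n) -> is_Cseries u s -> is_Cseries v s.
Proof. apply (@is_series_ext C_AbsRing C_NormedModule). Qed.

Lemma is_Cseries_plus (u v : nat -> C) (s t : C) :
  is_Cseries u s -> is_Cseries v t -> is_Cseries (fun n => u n + v n) (s + t).
Proof. apply (@is_series_plus C_AbsRing C_NormedModule). Qed.

Lemma is_Cseries_scal (a : C) (u : nat -> C) (s : C) :
  is_Cseries u s -> is_Cseries (fun n => a * u n) (a * s).
Proof. apply (@is_series_scal C_AbsRing C_NormedModule). Qed.

Lemma is_Cseries_minus (u v : nat -> C) (s t : C) :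
  is_Cseries u s -> is_Cseries v t -> is_Cseries (fun n => u n - v n) (s - t).
Proof. apply (@is_series_minus C_AbsRing C_NormedModule). Qed.

Lemma is_Cseries_incr_1 (u : nat -> C) (s : C) :
  is_Cseries u s -> is_Cseries (fun n => u (S n)) (s - u O).
Proof.
  intros H. apply (@is_series_incr_1 C_AbsRing C_NormedModule).
  match goal with |- is_series _ ?l => replace l with s; [exact H|] end.
  change (s = s - u O + u O). ring.
Qed.

Lemma is_Cseries_decr_1 (u : nat -> C) (s : C) :
  is_Cseries (fun n => u (S n)) s -> is_Cseries u (u O + s).
Proof.
  intros H. apply (@is_series_decr_1 C_AbsRing C_NormedModule).
  match goal with |- is_series _ ?l => replace l with s; [exact H|] end.
  change (s = u O + s + - u O). ring.
Qed.

Lemma is_Cseries_conj (u : nat -> C) (s : C) :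
  is_Cseries u s -> is_Cseries (fun n => Cconj (u n)) (Cconj s).
Proof.
  intros H.
  apply (@filterlim_locally_ball_norm C_AbsRing nat C_NormedModule eventually _).
  intros eps.
  destruct (proj1 (@filterlim_locally_ball_norm C_AbsRing nat C_NormedModule
                     eventually _ _ _) H eps) as [N HN].
  exists N. intros n Hn. specialize (HN n Hn). revert HN.
  unfold ball_norm.
  change (Cmod (sum_n u n - s) < eps ->
          Cmod (sum_n (fun k => Cconj (u k)) n - Cconj s) < eps)%R.
  replace (sum_n (fun k => Cconj (u k)) n) with (Cconj (sum_n u n)).
  - rewrite <- Cminus_conj, Cmod_conj. easy.
  - clear. induction n as [|n IH]; [now rewrite !sum_O|].
    rewrite !sum_Sn, <- IH. apply Cplus_conj.
Qed.

Lemma Cmod_sum_n (u : nat -> C) (n : nat) :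
  (Cmod (sum_n u n) <= sum_n (fun k => Cmod (u k)) n)%R.
Proof.
  induction n as [|n IH]; [rewrite !sum_O; apply Rle_refl|].
  rewrite !sum_Sn. eapply Rle_trans; [apply Cmod_triangle|].
  apply Rplus_le_compat_r, IH.
Qed.

Lemma sum_n_le (a b : nat -> R) (n : nat) :
  (forall k, (k <= n)%nat -> (a k <= b k)%R) -> (sum_n a n <= sum_n b n)%R.
Proof.
  induction n as [|n IH]; intros H; [rewrite !sum_O; apply H; lia|].
  rewrite !sum_Sn. apply Rplus_le_compat; [apply IH; intros; apply H; lia|apply H; lia].
Qed.

Lemma sum_n_nonneg_le_Series (a : nat -> R) (n : nat) :
  (forall k, (0 <= a k)%R) -> ex_series a -> (sum_n a n <= Series a)%R.
Proof.
  intros Ha Hs. rewrite (Series_incr_n a (S n)); [|lia|exact Hs].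
  rewrite sum_n_Reals. simpl Init.Nat.pred.
  assert (0 <= Series (fun k => a (S n + k)%nat))%R; [|lra].
  replace 0%R with (Series (fun _ => 0%R)).
  - apply Series_le; [intros k; split; [lra|apply Ha]|].
    now apply (ex_series_incr_n a (S n)).
  - apply is_series_unique. apply is_series_Reals. intros e He. exists O. intros.
    rewrite <- sum_n_Reals, sum_n_const. unfold R_dist.
    rewrite Rmult_0_r, Rminus_0_r, Rabs_R0. exact He.
Qed.

Lemma ex_series_bounded (a : nat -> R) (M : R) :
  (forall k, (0 <= a k)%R) -> (forall n, (sum_n a n <= M)%R) ->
  ex_series a /\ (Series a <= M)%R.
Proof.
  intros Ha HM.
  destruct (ex_finite_lim_seq_incr (sum_n a) M) as [l Hl]; [|exact HM|].
  - intros n. rewrite sum_Sn. pose proof (Ha (S n)).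
    change (sum_n a n <= sum_n a n + a (S n))%R. lra.
  - assert (Hs : is_series a l) by exact Hl.
    split; [now exists l|]. rewrite (is_series_unique _ _ Hs).
    apply (is_lim_seq_le (sum_n a) (fun _ => M) l M HM Hl), is_lim_seq_const.
Qed.

Lemma ex_series_le_nonneg (a b : nat -> R) :
  (forall n, (0 <= a n <= b n)%R) -> ex_series b -> ex_series a.
Proof.
  intros H. apply (@ex_series_le R_AbsRing R_CompleteNormedModule).
  intros n. change (Rabs (a n) <= b n)%R. rewrite Rabs_pos_eq; apply H.
Qed.

Lemma abs_summable_le (u : nat -> C) (b : nat -> R) :
  (forall n, (Cmod (u n) <= b n)%R) -> ex_series b -> abs_summable u.
Proof.
  intros H. apply ex_series_le_nonneg. intros n. split; [apply Cmod_ge_0|apply H].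
Qed.

Lemma is_Cseries_Cmod_le (u : nat -> C) (s : C) (M : R) :
  is_Cseries u s -> (forall n, (Cmod (sum_n u n) <= M)%R) -> (Cmod s <= M)%R.
Proof.
  intros H HM.
  assert (Hl : is_lim_seq (fun n => Cmod (sum_n u n)) (Cmod s)).
  { exact (filterlim_comp _ _ _ (sum_n u) Cmod _ _ _ H
             (@filterlim_norm C_AbsRing C_NormedModule s)). }
  apply (is_lim_seq_le _ (fun _ => M) (Cmod s) M HM Hl), is_lim_seq_const.
Qed.

Lemma Cmod_CSeries_le (u : nat -> C) :
  abs_summable u -> (Cmod (CSeries u) <= Series (fun n => Cmod (u n)))%R.
Proof.
  intros H. apply (is_Cseries_Cmod_le u); [now apply abs_summable_series|].
  intros n. eapply Rle_trans; [apply Cmod_sum_n|].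
  apply sum_n_nonneg_le_Series; [intros; apply Cmod_ge_0|exact H].
Qed.

Lemma Series_tail_small (v : nat -> R) (eps : R) :
  ex_series v -> (0 < eps)%R ->
  exists N, forall n, (N <= n)%nat -> (Rabs (Series (fun k => v (S n + k)%nat)) < eps)%R.
Proof.
  intros Hv He. pose proof (Series_correct v Hv) as H.
  apply is_series_Reals in H. destruct (H eps He) as [N HN].
  exists N. intros n Hn. specialize (HN n Hn). revert HN. unfold R_dist.
  rewrite (Series_incr_n v (S n)); [|lia|exact Hv]. simpl Init.Nat.pred.
  rewrite Rabs_minus_sym. intros HN. eapply Rle_lt_trans; [|exact HN].
  right. f_equal. ring.
Qed.

Lemma filter_forall_le {T : Type} (F : (T -> Prop) -> Prop) {FF : Filter F}
    (P : nat -> T -> Prop) (N : nat) :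
  (forall j, F (P j)) -> F (fun x => forall j, (j <= N)%nat -> P j x).
Proof.
  intros H. induction N as [|N IH].
  - apply (filter_imp (P O)); [|apply H]. intros x Hx j Hj.
    replace j with O by lia. exact Hx.
  - apply (filter_imp (fun x => (forall j, (j <= N)%nat -> P j x) /\ P (S N) x)).
    + intros x [H1 H2] j Hj. destruct (Nat.eq_dec j (S N)) as [->|]; [exact H2|].
      apply H1. lia.
    + apply filter_and; [exact IH|apply H].
Qed.

(** Dominated convergence for series: the tails are controlled by [v] uniformly in [x], and a filter
    is stable under the finite intersections that the head requires. The filter is arbitrary because
    the lemma serves both for partial sums at infinity and for [w] tending to [z] within a disk. *)
Lemma tannery {T : Type} (F : (T -> Prop) -> Prop) {FF : Filter F}
    (w : T -> nat -> C) (t : nat -> C) (v : nat -> R) :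
  ex_series v ->
  F (fun x => forall j, (Cmod (w x j) <= v j)%R) ->
  (forall j, (Cmod (t j) <= v j)%R) ->
  (forall j eps, (0 < eps)%R -> F (fun x => (Cmod (w x j - t j) < eps)%R)) ->
  forall eps, (0 < eps)%R -> F (fun x => (Cmod (CSeries (w x) - CSeries t) < eps)%R).
Proof.
  intros Hv Hw Ht Hlim eps He.
  (* The head will contribute at most [eps / 4] and the tail, dominated by [2 * v], at most
     [eps / 2]. *)
  destruct (Series_tail_small v (eps / 4) Hv ltac:(lra)) as [N HN].
  specialize (HN N (le_n N)).
  assert (Hd : (0 < eps / (4 * INR (S N)))%R).
  { apply Rdiv_lt_0_compat; [lra|]. pose proof (lt_0_INR (S N) ltac:(lia)). lra. }
  generalize (filter_and _ _ Hw (filter_forall_le F _ N (fun j => Hlim j _ Hd))).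
  apply filter_imp. intros x [H1 H2].
  assert (Hsw : abs_summable (w x)) by now apply (abs_summable_le _ v).
  assert (Hst : abs_summable t) by now apply (abs_summable_le _ v).
  set (d := fun j => w x j - t j).
  assert (Hdv : forall j, (Cmod (d j) <= 2 * v j)%R).
  { intros j. unfold d. eapply Rle_trans; [apply Cmod_triangle|]. rewrite Cmod_opp.
    specialize (H1 j). specialize (Ht j). lra. }
  assert (Hv2 : ex_series (fun j => (2 * v j)%R))
    by exact (@ex_series_scal R_AbsRing R_NormedModule 2%R v Hv).
  assert (Hsd : abs_summable d) by now apply (abs_summable_le _ (fun j => 2 * v j)%R).
  rewrite <- (is_Cseries_unique d (CSeries (w x) - CSeries t)).
  2:{ apply is_Cseries_minus; now apply abs_summable_series. }
  eapply Rle_lt_trans; [now apply Cmod_CSeries_le|].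
  rewrite (Series_incr_n _ (S N)); [|lia|exact Hsd]. simpl Init.Nat.pred.
  assert (A1 : (sum_f_R0 (fun j => Cmod (d j)) N <= eps / 4)%R).
  { rewrite <- sum_n_Reals.
    eapply Rle_trans; [apply (sum_n_le _ (fun _ => eps / (4 * INR (S N)))%R)|].
    - intros k Hk. left. apply H2, Hk.
    - rewrite sum_n_const. right. field. apply not_0_INR. lia. }
  assert (A2 : (Series (fun k => Cmod (d (S N + k)%nat)) <= 2 * (eps / 4))%R).
  { eapply Rle_trans; [apply (Series_le _ (fun k => 2 * v (S N + k)%nat)%R)|].
    - intros k. split; [apply Cmod_ge_0|apply Hdv].
    - now apply (ex_series_incr_n (fun j => 2 * v j)%R (S N)).
    - rewrite Series_scal_l. apply Rmult_le_compat_l; [lra|].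
      eapply Rle_trans; [apply Rle_abs|]. left. exact HN. }
  cbv beta in *. lra.
Qed.

Lemma is_Cseries_sum_n (u : nat -> nat -> C) (s : nat -> C) (M : nat) :
  (forall m, is_Cseries (u m) (s m)) ->
  is_Cseries (fun j => sum_n (fun m => u m j) M) (sum_n s M).
Proof.
  intros H. induction M as [|M IH].
  - rewrite sum_O. apply (is_Cseries_ext (u O)); [|apply H].
    intros n. now rewrite sum_O.
  - rewrite sum_Sn.
    apply (is_Cseries_ext (fun j => sum_n (fun m => u m j) M + u (S M) j)).
    + intros n. now rewrite sum_Sn.
    + apply is_Cseries_plus; [exact IH|apply H].
Qed.

(** A finite sum of row series is one series over [j] whose terms are partial column sums. These are
    dominated by [v] and converge to the full column sums, so Tannery's theorem performs the
    interchange. *)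
Lemma fubini (u : nat -> nat -> C) (v : nat -> R) :
  (forall j M, (sum_n (fun m => Cmod (u m j)) M <= v j)%R) -> ex_series v ->
  abs_summable (fun m => CSeries (u m)) /\
  is_Cseries (fun m => CSeries (u m)) (CSeries (fun j => CSeries (fun m => u m j))).
Proof.
  intros Hu Hv.
  assert (Hle : forall m j, (Cmod (u m j) <= v j)%R).
  { intros m j. eapply Rle_trans; [|apply (Hu j m)].
    destruct m as [|m]; [rewrite sum_O; apply Rle_refl|]. rewrite sum_Sn.
    assert (0 <= sum_n (fun m => Cmod (u m j)) m)%R.
    { clear. induction m; [rewrite sum_O; apply Cmod_ge_0|rewrite sum_Sn].
      apply Rplus_le_le_0_compat; [exact IHm|apply Cmod_ge_0]. }
    change (Cmod (u (S m) j) <= sum_n (fun m => Cmod (u m j)) m + Cmod (u (S m) j))%R.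
    lra. }
  assert (Hs : forall m, abs_summable (u m))
    by (intros m; apply (abs_summable_le _ v); auto).
  assert (Hs' : forall j, abs_summable (fun m => u m j)).
  { intros j. apply (ex_series_bounded _ (v j)); [intros; apply Cmod_ge_0|apply Hu]. }
  assert (HS : forall M, is_Cseries (fun j => sum_n (fun m => u m j) M)
                 (sum_n (fun m => CSeries (u m)) M)).
  { intros M. apply is_Cseries_sum_n. intros m. now apply abs_summable_series. }
  split.
  (* Finitely many rows of moduli may be added termwise; the result is bounded by [Series v]
     whatever [M] is. *)
  - assert (HR : forall M,
      is_series (fun j => sum_n (fun m => Cmod (u m j)) M)
        (sum_n (fun m => Series (fun j => Cmod (u m j))) M)).
    { induction M as [|M IH].
      - rewrite sum_O. apply (is_series_ext (fun j => Cmod (u O j))).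
        + intros j. now rewrite sum_O.
        + apply Series_correct, Hs.
      - rewrite sum_Sn.
        apply (is_series_ext
                 (fun j => plus (sum_n (fun m => Cmod (u m j)) M) (Cmod (u (S M) j)))).
        + intros j. now rewrite sum_Sn.
        + apply (@is_series_plus R_AbsRing R_NormedModule); [exact IH|].
          apply Series_correct, Hs. }
    apply (ex_series_bounded _ (Series v)); [intros; apply Cmod_ge_0|].
    intros M. eapply Rle_trans.
    + apply (sum_n_le _ (fun m => Series (fun j => Cmod (u m j)))). intros m _.
      apply Cmod_CSeries_le, Hs.
    + rewrite <- (is_series_unique _ _ (HR M)). apply Series_le; [|exact Hv].
      intros j. split; [|apply Hu]. eapply Rle_trans; [apply Cmod_ge_0|apply Cmod_sum_n].
  - apply (@filterlim_locally_ball_norm C_AbsRing nat C_NormedModule eventually _).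
    intros eps. unfold ball_norm.
    apply (filter_imp (fun M => (Cmod (CSeries (fun j => sum_n (fun m => u m j) M) -
               CSeries (fun j => CSeries (fun m => u m j))) < eps)%R)).
    { intros M. now rewrite (is_Cseries_unique _ _ (HS M)). }
    apply (tannery eventually _ _ v Hv); [| | |apply cond_pos].
    + exists O. intros M _ j. eapply Rle_trans; [apply Cmod_sum_n|apply Hu].
    + intros j. eapply Rle_trans; [apply Cmod_CSeries_le, Hs'|].
      apply (ex_series_bounded (fun m => Cmod (u m j)) (v j)); [intros; apply Cmod_ge_0|apply Hu].
    + intros j e He. pose proof (abs_summable_series _ (Hs' j)) as H.
      exact (proj1 (@filterlim_locally_ball_norm C_AbsRing nat C_NormedModule
                eventually _ _ _) H (mkposreal e He)).
Qed.

(** * Series indexed by the integers *)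

Lemma abs_summableZ_succ (a : Z -> C) :
  abs_summableZ a -> abs_summableZ (fun k => a (k + 1)%Z).
Proof.
  intros [H1 H2]. split.
  - apply (ex_series_ext (fun n => Cmod (a (Z.of_nat (S n))))).
    + intros n. do 2 f_equal. lia.
    + now apply (ex_series_incr_1 (fun n => Cmod (a (Z.of_nat n)))).
  - apply ex_series_incr_1.
    apply (ex_series_ext (fun n => Cmod (a (- Z.of_nat (S n))%Z))); [|exact H2].
    intros n. do 2 f_equal. lia.
Qed.

Lemma abs_summableZ_shift (a : Z -> C) (j : nat) :
  abs_summableZ a -> abs_summableZ (fun k => a (k + Z.of_nat j)%Z).
Proof.
  intros H. induction j as [|j IH].
  - destruct H as [H1 H2]. split; [revert H1|revert H2]; apply ex_series_ext;
      intros n; do 2 f_equal; lia.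
  - destruct (abs_summableZ_succ _ IH) as [H1 H2].
    split; [revert H1|revert H2]; apply ex_series_ext; intros n; do 2 f_equal; lia.
Qed.

Lemma CSeries_ext (u v : nat -> C) :
  (forall n, u n = v n) -> CSeries u = CSeries v.
Proof. intros H. f_equal. now apply functional_extensionality. Qed.

Lemma CSeriesZ_ext (a b : Z -> C) : (forall k, a k = b k) -> CSeriesZ a = CSeriesZ b.
Proof. intros H. f_equal. now apply functional_extensionality. Qed.

(** The shift only moves the term [a 0] from the nonnegative half to the negative one. *)
Lemma CSeriesZ_succ (a : Z -> C) :
  abs_summableZ a -> CSeriesZ (fun k => a (k + 1)%Z) = CSeriesZ a.
Proof.
  intros [H1 H2]. unfold CSeriesZ.
  pose proof (abs_summable_series _ H1) as S1.
  pose proof (abs_summable_series _ H2) as S2.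
  rewrite (is_Cseries_unique (fun n => a (Z.of_nat n + 1)%Z)
             (CSeries (fun n => a (Z.of_nat n)) - a 0%Z)).
  2:{ apply (is_Cseries_ext (fun n => a (Z.of_nat (S n)))).
      - intros n. f_equal. lia.
      - now apply (is_Cseries_incr_1 (fun n => a (Z.of_nat n))). }
  rewrite (is_Cseries_unique (fun n => a (- Z.of_nat (S n) + 1)%Z)
             (a 0%Z + CSeries (fun n => a (- Z.of_nat (S n))%Z))).
  2:{ apply (is_Cseries_decr_1 (fun n => a (- Z.of_nat (S n) + 1)%Z)).
      apply (is_Cseries_ext (fun n => a (- Z.of_nat (S n))%Z)); [|exact S2].
      intros n. f_equal. lia. }
  ring.
Qed.

Lemma CSeriesZ_shift (a : Z -> C) (j : nat) :
  abs_summableZ a -> CSeriesZ (fun k => a (k + Z.of_nat j)%Z) = CSeriesZ a.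
Proof.
  intros H. induction j as [|j IH].
  - apply CSeriesZ_ext. intros k. f_equal. lia.
  - rewrite <- IH, <- (CSeriesZ_succ _ (abs_summableZ_shift a j H)).
    apply CSeriesZ_ext. intros k. f_equal. lia.
Qed.

Definition normZ (a : Z -> C) : R :=
  (Series (fun n => Cmod (a (Z.of_nat n))) +
   Series (fun n => Cmod (a (- Z.of_nat (S n))%Z)))%R.

Lemma normZ_succ (a : Z -> C) :
  abs_summableZ a -> normZ (fun k => a (k + 1)%Z) = normZ a.
Proof.
  intros H. pose proof (abs_summableZ_succ a H) as [_ H2']. destruct H as [H1 H2].
  unfold normZ.
  rewrite (Series_incr_1 (fun n => Cmod (a (Z.of_nat n))) H1).
  rewrite (Series_incr_1 (fun n => Cmod (a (- Z.of_nat (S n) + 1)%Z)) H2').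
  rewrite (Series_ext (fun n => Cmod (a (Z.of_nat (S n))))
             (fun n => Cmod (a (Z.of_nat n + 1)%Z))).
  2:{ intros n. do 2 f_equal. lia. }
  rewrite (Series_ext (fun n => Cmod (a (- Z.of_nat (S (S n)) + 1)%Z))
             (fun n => Cmod (a (- Z.of_nat (S n))%Z))).
  2:{ intros n. do 2 f_equal. lia. }
  simpl (a (- Z.of_nat 1 + 1)%Z). simpl (Z.of_nat 0). ring.
Qed.

Lemma normZ_shift (a : Z -> C) (j : nat) :
  abs_summableZ a -> normZ (fun k => a (k + Z.of_nat j)%Z) = normZ a.
Proof.
  intros H. induction j as [|j IH].
  - f_equal. apply functional_extensionality. intros k. f_equal. lia.
  - rewrite <- IH, <- (normZ_succ _ (abs_summableZ_shift a j H)).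
    f_equal. apply functional_extensionality. intros k. f_equal. lia.
Qed.

Lemma Series_Cmod_nonneg (u : nat -> C) :
  abs_summable u -> (0 <= Series (fun n => Cmod (u n)))%R.
Proof.
  intros H. eapply Rle_trans; [apply Cmod_ge_0|apply (Cmod_CSeries_le u H)].
Qed.

Lemma halves_le_normZ (a : Z -> C) : abs_summableZ a ->
  (forall M, sum_n (fun n => Cmod (a (Z.of_nat n))) M <= normZ a)%R /\
  (forall M, sum_n (fun n => Cmod (a (- Z.of_nat (S n))%Z)) M <= normZ a)%R.
Proof.
  intros [H1 H2]. unfold normZ.
  pose proof (Series_Cmod_nonneg (fun n => a (Z.of_nat n)) H1).
  pose proof (Series_Cmod_nonneg (fun n => a (- Z.of_nat (S n))%Z) H2).
  split; intros M.
  - pose proof (sum_n_nonneg_le_Series _ M (fun n => Cmod_ge_0 (a (Z.of_nat n))) H1). lra.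
  - pose proof (sum_n_nonneg_le_Series _ M
                  (fun n => Cmod_ge_0 (a (- Z.of_nat (S n))%Z)) H2). lra.
Qed.

Lemma Cmod_CSeries_bound (u : nat -> C) (M : R) :
  (forall n, sum_n (fun k => Cmod (u k)) n <= M)%R -> (Cmod (CSeries u) <= M)%R.
Proof.
  intros H. destruct (ex_series_bounded _ M (fun k => Cmod_ge_0 (u k)) H) as [E L].
  eapply Rle_trans; [apply Cmod_CSeries_le, E|exact L].
Qed.

Lemma CSeries_scal (b : C) (u : nat -> C) :
  abs_summable u -> CSeries (fun n => b * u n) = b * CSeries u.
Proof.
  intros H. apply is_Cseries_unique, is_Cseries_scal. now apply abs_summable_series.
Qed.

Lemma sum_n_Cmod_scal (b : C) (u : nat -> C) (M : nat) :
  sum_n (fun m => Cmod (b * u m)) M = (Cmod b * sum_n (fun m => Cmod (u m)) M)%R.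
Proof.
  induction M as [|M IH]; [rewrite !sum_O; apply Cmod_mult|].
  rewrite !sum_Sn, IH, Cmod_mult. symmetry. apply Rmult_plus_distr_l.
Qed.

(** A correlation instead of a convolution: on the circle the conjugate of [z^j] is [z^(-j)], so
    multiplying a Laurent series by a conjugated Taylor series collects the coefficients at [k + j]
    into slot [k]. *)
Definition corr (b : nat -> C) (q : Z -> C) (k : Z) : C :=
  CSeries (fun j => b j * q (k + Z.of_nat j)%Z).

(** By translation invariance the sum of [q (k + j)] over [k] does not depend on [j], so it factors
    out once the order of summation is exchanged. The dominating sequence is [Cmod (b j)] times the
    l1 norm of [q]. *)
Lemma corr_CSeriesZ (b : nat -> C) (q : Z -> C) :
  abs_summable b -> abs_summableZ q ->
  abs_summableZ (corr b q) /\ CSeriesZ (corr b q) = CSeries b * CSeriesZ q.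
Proof.
  intros Hb Hq.
  set (v := fun j => (Cmod (b j) * normZ q)%R).
  assert (Hv : ex_series v) by (apply ex_series_scal_r, Hb).
  assert (Hh : forall j,
    (forall M, sum_n (fun m => Cmod (q (Z.of_nat m + Z.of_nat j)%Z)) M <= normZ q)%R /\
    (forall M, sum_n (fun m => Cmod (q (- Z.of_nat (S m) + Z.of_nat j)%Z)) M <= normZ q)%R).
  { intros j. rewrite <- (normZ_shift q j Hq).
    exact (halves_le_normZ _ (abs_summableZ_shift q j Hq)). }
  destruct (fubini (fun m j => b j * q (Z.of_nat m + Z.of_nat j)%Z) v) as [A1 B1].
  { intros j M. rewrite (sum_n_Cmod_scal (b j) (fun m => q (Z.of_nat m + Z.of_nat j)%Z)).
    apply Rmult_le_compat_l; [apply Cmod_ge_0|apply Hh]. }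
  { exact Hv. }
  destruct (fubini (fun m j => b j * q (- Z.of_nat (S m) + Z.of_nat j)%Z) v) as [A2 B2].
  { intros j M.
    rewrite (sum_n_Cmod_scal (b j) (fun m => q (- Z.of_nat (S m) + Z.of_nat j)%Z)).
    apply Rmult_le_compat_l; [apply Cmod_ge_0|apply Hh]. }
  { exact Hv. }
  split; [split; [exact A1|exact A2]|].
  unfold CSeriesZ at 1. unfold corr.
  rewrite (is_Cseries_unique _ _ B1), (is_Cseries_unique _ _ B2).
  set (P := fun j => CSeries (fun m => q (Z.of_nat m + Z.of_nat j)%Z)).
  set (N := fun j => CSeries (fun m => q (- Z.of_nat (S m) + Z.of_nat j)%Z)).
  rewrite (CSeries_ext _ (fun j => b j * P j)).
  2:{ intros j. apply CSeries_scal, (abs_summableZ_shift q j Hq). }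
  rewrite (CSeries_ext (fun j => CSeries (fun m => _ * q (- _ + _)%Z)) (fun j => b j * N j)).
  2:{ intros j. apply CSeries_scal, (abs_summableZ_shift q j Hq). }
  assert (SP : abs_summable (fun j => b j * P j)).
  { apply (abs_summable_le _ v); [|exact Hv]. intros j. rewrite Cmod_mult.
    apply Rmult_le_compat_l; [apply Cmod_ge_0|]. apply Cmod_CSeries_bound, Hh. }
  assert (SN : abs_summable (fun j => b j * N j)).
  { apply (abs_summable_le _ v); [|exact Hv]. intros j. rewrite Cmod_mult.
    apply Rmult_le_compat_l; [apply Cmod_ge_0|]. apply Cmod_CSeries_bound, Hh. }
  rewrite <- (is_Cseries_unique _ _ (is_Cseries_plus _ _ _ _
                (abs_summable_series _ SP) (abs_summable_series _ SN))).
  rewrite (CSeries_ext _ (fun j => CSeriesZ q * b j)).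
  - rewrite CSeries_scal; [ring|exact Hb].
  - intros j. rewrite <- (CSeriesZ_shift q j Hq). unfold CSeriesZ, P, N. ring.
Qed.

(** * Cauchy's estimate for Laurent series *)

(* Coquelicot states sums at the carrier of its own structures, where [ring] does not
   recognize [C]. *)
Ltac cring := first [ring | match goal with |- ?a = ?b => change (@eq C a b); ring end].

Definition cis (t : R) : C := (cos t, sin t).

Lemma cis_add (s t : R) : cis (s + t) = cis s * cis t.
Proof.
  unfold cis. rewrite cos_plus, sin_plus. unfold Cmult. simpl. f_equal. ring.
Qed.

Lemma cis_pow (t : R) (n : nat) : cis t ^ n = cis (INR n * t).
Proof.
  induction n as [|n IH].
  - simpl. unfold cis. rewrite Rmult_0_l, cos_0, sin_0. reflexivity.
  - rewrite Cpow_S, IH, <- cis_add, S_INR. f_equal. ring.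
Qed.

Lemma Cmod_cis (t : R) : Cmod (cis t) = 1%R.
Proof.
  unfold Cmod, cis. simpl. rewrite !Rmult_1_r.
  pose proof (sin2_cos2 t) as H. unfold Rsqr in H.
  replace (cos t * cos t + sin t * sin t)%R with 1%R by lra. apply sqrt_1.
Qed.

Lemma cis_2PI_INR (n : nat) : cis (2 * PI * INR n) = 1.
Proof.
  unfold cis. replace (2 * PI * INR n)%R with (0 + 2 * INR n * PI)%R by ring.
  now rewrite cos_period, sin_period, cos_0, sin_0.
Qed.

(** From [cos (2a) = 1 - 2 sin(a)^2] with [a = |x|/2], which lies strictly between [0] and [PI],
    where the sine is positive. *)
Lemma cis_neq_1 (x : R) : (0 < Rabs x < 2 * PI)%R -> cis x <> 1.
Proof.
  intros [H0 H1] E. injection E as Ec _.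
  assert (Hc : cos (Rabs x) = 1%R).
  { unfold Rabs. destruct (Rcase_abs x); [now rewrite cos_neg|exact Ec]. }
  replace (Rabs x) with (2 * (Rabs x / 2))%R in Hc by field.
  rewrite cos_2a_sin in Hc.
  pose proof (sin_gt_0 (Rabs x / 2) ltac:(lra) ltac:(lra)) as Hs.
  nra.
Qed.

Lemma sum_n_scal (b : C) (u : nat -> C) (n : nat) :
  sum_n (fun k => b * u k) n = b * sum_n u n.
Proof. apply (@sum_n_mult_l C_Ring). Qed.

Lemma sum_n_geom (q : C) (n : nat) : (q - 1) * sum_n (fun j => q ^ j) n = q ^ S n - 1.
Proof.
  induction n as [|n IH]; [rewrite sum_O; simpl; cring|].
  rewrite sum_Sn. change (plus ?a ?b) with (a + b).
  rewrite Cmult_plus_distr_l, IH. simpl. cring.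
Qed.

Lemma sum_n_single (u : nat -> C) (k n : nat) :
  (forall i, (i <= n)%nat -> i <> k -> u i = 0) ->
  sum_n u n = if le_dec k n then u k else RtoC 0.
Proof.
  induction n as [|n IH]; intros H.
  - rewrite sum_O. destruct (le_dec k 0).
    + now replace k with O by lia.
    + apply H; lia.
  - rewrite sum_Sn, IH by (intros; apply H; lia). change (plus ?a ?b) with (a + b).
    destruct (le_dec k n), (le_dec k (S n)); try lia.
    + rewrite (H (S n)) by lia. cring.
    + replace (S n) with k by lia. cring.
    + rewrite (H (S n)) by lia. cring.
Qed.

(* Average [p(z) z^(-k)] over the (K+1)-st roots of unity. *)
Lemma poly_coef_bound (p : nat -> C) (K : nat) (M : R) :
  (forall z, circle z -> (Cmod (sum_n (fun i => p i * z ^ i)%C K) <= M)%R) ->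
  forall k, (k <= K)%nat -> (Cmod (p k) <= M)%R.
Proof.
  intros H k Hk.
  set (th := (2 * PI / INR (S K))%R).
  assert (HN : (0 < INR (S K))%R) by (apply lt_0_INR; lia).
  pose proof PI_RGT_0 as HPI.
  set (q := fun i => cis (th * (INR i - INR k))).
  set (A := sum_n (fun j => cis (- (INR j * th * INR k)) *
                             sum_n (fun i => p i * cis (INR j * th) ^ i) K) K).
  (* Exchanging the two sums leaves, for each [i], the geometric sum of the powers of [q i]: it
     equals [K + 1] for [i = k] and vanishes otherwise, [q i] being a root of unity different from
     [1]. *)
  assert (HA : A = RtoC (INR (S K)) * p k).
  { unfold A. transitivity (sum_n (fun j => sum_n (fun i => p i * q i ^ j) K) K).
    - apply sum_n_ext. intros j. rewrite <- sum_n_scal. apply sum_n_ext. intros i.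
      unfold q. rewrite !cis_pow.
      replace (INR j * (th * (INR i - INR k)))%R
        with (- (INR j * th * INR k) + INR i * (INR j * th))%R by cring.
      rewrite cis_add. cring.
    - rewrite sum_n_switch.
      rewrite (sum_n_ext _ (fun i => p i * sum_n (fun j => q i ^ j) K))
        by (intros i; apply sum_n_scal).
      rewrite (sum_n_single _ k).
      + destruct (le_dec k K); [|lia]. unfold q.
        replace (th * (INR k - INR k))%R with (2 * PI * INR 0)%R by (simpl; cring).
        rewrite cis_2PI_INR.
        rewrite (sum_n_ext _ (fun _ => RtoC 1)) by (intros; apply Cpow_1_l).
        replace (sum_n (fun _ => RtoC 1) K) with (RtoC (INR (S K))); [cring|].
        clear. induction K as [|K IH]; [now rewrite sum_O|].
        rewrite sum_Sn, <- IH, S_INR. apply RtoC_plus.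
      + intros i Hi Hik.
        (* Since [i] and [k] are distinct and at most [K], the angle has modulus between [th] and
           [th * K], strictly inside the interval from [0] to [2 * PI]. *)
        assert (Hq : q i <> 1).
        { apply cis_neq_1. unfold th. rewrite Rabs_mult.
          rewrite (Rabs_pos_eq (2 * PI / INR (S K)))
            by (left; apply Rdiv_lt_0_compat; lra).
          assert (D : (1 <= Rabs (INR i - INR k) <= INR K)%R).
          { rewrite !INR_IZR_INZ, <- minus_IZR, <- abs_IZR.
            split; apply IZR_le; lia. }
          rewrite S_INR in *. split.
          - apply Rmult_lt_0_compat; [apply Rdiv_lt_0_compat; lra|lra].
          - replace (2 * PI)%R with (2 * PI / (INR K + 1) * (INR K + 1))%R at 2
              by (field; lra).
            apply Rmult_lt_compat_l; [apply Rdiv_lt_0_compat; lra|lra]. }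
        assert (HqN : q i ^ S K = 1).
        { unfold q. rewrite cis_pow.
          replace (INR (S K) * (th * (INR i - INR k)))%R
            with (2 * PI * INR i + - (2 * PI * INR k))%R by (unfold th; field; lra).
          rewrite cis_add, cis_2PI_INR.
          assert (E : cis (- (2 * PI * INR k)) * cis (2 * PI * INR k) = 1).
          { rewrite <- cis_add, Rplus_opp_l. unfold cis. now rewrite cos_0, sin_0. }
          rewrite cis_2PI_INR, Cmult_1_r in E. rewrite E. cring. }
        pose proof (sum_n_geom (q i) K) as G. rewrite HqN in G.
        replace (sum_n (fun j => q i ^ j) K) with (RtoC 0); [cring|].
        replace (1 - 1) with (RtoC 0) in G by cring.
        destruct (Ceq_dec (sum_n (fun j => q i ^ j) K) 0) as [->|E]; [easy|].
        exfalso. apply (Cmult_neq_0 (q i - 1) (sum_n (fun j => q i ^ j) K)); [|exact E|exact G].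
        intros E'. apply Hq. rewrite <- (Cplus_0_r 1), <- E'. cring. }
  assert (HM : (Cmod A <= INR (S K) * M)%R).
  { unfold A. eapply Rle_trans; [apply Cmod_sum_n|].
    eapply Rle_trans; [apply (sum_n_le _ (fun _ => M))|rewrite sum_n_const; lra].
    intros j _. rewrite Cmod_mult, Cmod_cis, Rmult_1_l. apply H, Cmod_cis. }
  rewrite HA, Cmod_mult, Cmod_R, Rabs_pos_eq in HM by lra.
  now apply Rmult_le_reg_l in HM.
Qed.

(** * Integer powers and symmetric truncations of Laurent series *)

Lemma CpowZ_of_nat (z : C) (n : nat) : CpowZ z (Z.of_nat n) = z ^ n.
Proof.
  destruct n as [|n]; [reflexivity|]. unfold CpowZ, Z.of_nat.
  now rewrite SuccNat2Pos.id_succ.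
Qed.

Lemma CpowZ_opp_of_nat (z : C) (n : nat) : CpowZ z (- Z.of_nat n) = / z ^ n.
Proof.
  destruct n as [|n]; [simpl; field|]. unfold CpowZ, Z.of_nat, Z.opp.
  now rewrite SuccNat2Pos.id_succ.
Qed.

Lemma CpowZ_succ (z : C) (k : Z) : z <> 0 -> CpowZ z (k + 1) = CpowZ z k * z.
Proof.
  intros Hz. destruct (Z_le_dec 0 k) as [H|H].
  - replace k with (Z.of_nat (Z.to_nat k)) by lia.
    replace (Z.of_nat (Z.to_nat k) + 1)%Z with (Z.of_nat (S (Z.to_nat k))) by lia.
    rewrite !CpowZ_of_nat. simpl. cring.
  - replace k with (- Z.of_nat (S (Z.to_nat (- k - 1))))%Z by lia.
    set (m := Z.to_nat (- k - 1)).
    replace (- Z.of_nat (S m) + 1)%Z with (- Z.of_nat m)%Z by lia.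
    rewrite !CpowZ_opp_of_nat. simpl. field. split; [now apply Cpow_nz|exact Hz].
Qed.

Lemma CpowZ_add_nat (z : C) (k : Z) (n : nat) :
  z <> 0 -> CpowZ z (k + Z.of_nat n) = CpowZ z k * z ^ n.
Proof.
  intros Hz. induction n as [|n IH].
  - rewrite Z.add_0_r. simpl. cring.
  - replace (k + Z.of_nat (S n))%Z with ((k + Z.of_nat n) + 1)%Z by lia.
    rewrite CpowZ_succ, IH by exact Hz. simpl. cring.
Qed.

Lemma circle_neq_0 (z : C) : circle z -> z <> 0.
Proof.
  intros H E. unfold circle in H. rewrite E, Cmod_0 in H. lra.
Qed.

Lemma Cmod_CpowZ (z : C) (k : Z) : circle z -> Cmod (CpowZ z k) = 1%R.
Proof.
  intros H. pose proof (circle_neq_0 z H) as Hz. unfold circle in H.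
  destruct k as [|p|p]; simpl.
  - apply Cmod_1.
  - now rewrite Cmod_pow, H, pow1.
  - rewrite Cmod_inv by now apply Cpow_nz. rewrite Cmod_pow, H, pow1. apply Rinv_1.
Qed.

Lemma sum_n_S_l (u : nat -> C) (n : nat) :
  sum_n u (S n) = u O + sum_n (fun i => u (S i)) n.
Proof.
  induction n as [|n IH]; [now rewrite sum_Sn, !sum_O|].
  rewrite sum_Sn, IH, (sum_Sn (fun i => u (S i))).
  change (plus ?a ?b) with (a + b). cring.
Qed.

(** The lowest exponent of the truncation is [-(L+1) - 1], so the factor [z^(L+2)] produces a
    polynomial, in which the Laurent index [k] becomes [i = k + L + 1]. On the circle this factor
    has modulus [1], hence the polynomial estimate applies to the truncation. *)
Lemma laurent_truncation (a : Z -> C) (z : C) (L : nat) : z <> 0 ->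
  z ^ S (S L) * (sum_n (fun n => a (Z.of_nat n) * CpowZ z (Z.of_nat n - 1)) L +
     sum_n (fun n => a (- Z.of_nat (S n))%Z * CpowZ z (- Z.of_nat (S n) - 1)) L) =
  sum_n (fun i => a (Z.of_nat i - Z.of_nat (S L))%Z * z ^ i) (S (L + L)).
Proof.
  intros Hz.
  assert (E : forall n k : nat, z ^ n * CpowZ z (Z.of_nat k - Z.of_nat n) = z ^ k).
  { intros n k. rewrite Cmult_comm, <- CpowZ_add_nat by exact Hz.
    rewrite <- CpowZ_of_nat. f_equal. lia. }
  induction L as [|L IH].
  - rewrite sum_Sn, !sum_O. change (plus ?a ?b) with (a + b).
    pose proof (E 2%nat 1%nat) as E1. pose proof (E 2%nat 0%nat) as E2.
    simpl in *. rewrite !Cmult_1_r in *.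
    replace (z * z * (a 0%Z * / z + a (-1)%Z * / (z * z)))
      with (a 0%Z * (z * z * / z) + a (-1)%Z * (z * z * / (z * z))) by cring.
    rewrite E1, E2. cring.
  (* Passing to [L + 1] adds one coefficient at each end; the one at the lower end becomes the new
     constant term, so the former polynomial gets multiplied by [z]. *)
  - replace (S (S L + S L)) with (S (S (S (L + L)))) by lia.
    rewrite !(sum_Sn _ L), (sum_Sn _ (S (S (L + L)))), sum_n_S_l. change (plus ?a ?b) with (a + b).
    rewrite (sum_n_ext (fun i => a (Z.of_nat (S i) - Z.of_nat (S (S L)))%Z * z ^ S i)
               (fun i => z * (a (Z.of_nat i - Z.of_nat (S L))%Z * z ^ i))).
    2:{ intros i. replace (Z.of_nat (S i) - Z.of_nat (S (S L)))%Z
          with (Z.of_nat i - Z.of_nat (S L))%Z by lia. simpl. cring. }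
    rewrite sum_n_scal, <- IH. clear IH.
    replace (Z.of_nat (S (S (S (L + L)))) - Z.of_nat (S (S L)))%Z with (Z.of_nat (S L)) by lia.
    replace (Z.of_nat 0 - Z.of_nat (S (S L)))%Z with (- Z.of_nat (S (S L)))%Z by lia.
    set (U := sum_n _ L). set (V := sum_n _ L).
    pose proof (E (S (S (S L))) (S (S (S (L + L))))) as E1.
    pose proof (E (S (S (S L))) O) as E2.
    replace (Z.of_nat (S (S (S (L + L)))) - Z.of_nat (S (S (S L))))%Z
      with (Z.of_nat (S L) - 1)%Z in E1 by lia.
    replace (Z.of_nat 0 - Z.of_nat (S (S (S L))))%Z
      with (- Z.of_nat (S (S L)) - 1)%Z in E2 by lia.
    transitivity (z * (z ^ S (S L) * (U + V)) +
      a (Z.of_nat (S L)) * (z ^ S (S (S L)) * CpowZ z (Z.of_nat (S L) - 1)) +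
      a (- Z.of_nat (S (S L)))%Z * (z ^ S (S (S L)) * CpowZ z (- Z.of_nat (S (S L)) - 1))).
    + rewrite (Cpow_S z (S (S L))). cring.
    + rewrite E1, E2. cring.
Qed.

Lemma CSeries_tail (u : nat -> C) (N : nat) : abs_summable u ->
  (Cmod (CSeries u - sum_n u N) <= Series (fun k => Cmod (u (S N + k)%nat)))%R.
Proof.
  intros H.
  assert (Ht : abs_summable (fun k => u (S N + k)%nat))
    by now apply (ex_series_incr_n (fun k => Cmod (u k)) (S N)).
  assert (HI : is_Cseries (fun k => u (S N + k)%nat) (CSeries u - sum_n u N)).
  { apply (@is_series_incr_n C_AbsRing C_NormedModule); [lia|].
    simpl Init.Nat.pred. pose proof (abs_summable_series u H) as HS.
    match goal with |- is_series _ ?l => replace l with (CSeries u); [exact HS|] end.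
    change (CSeries u = CSeries u - sum_n u N + sum_n u N). cring. }
  rewrite <- (is_Cseries_unique _ _ HI). now apply Cmod_CSeries_le.
Qed.

Lemma abs_summableZ_Cmod_eq (a b : Z -> C) :
  (forall k, Cmod (b k) = Cmod (a k)) -> abs_summableZ a -> abs_summableZ b.
Proof.
  intros E [H1 H2]. split; [revert H1|revert H2]; apply ex_series_ext; intros n; now rewrite E.
Qed.

Lemma laurent_terms_summable (a : Z -> C) (z : C) :
  circle z -> abs_summableZ a -> abs_summableZ (fun k => a k * CpowZ z (k - 1)).
Proof.
  intros Hz. apply abs_summableZ_Cmod_eq. intros k.
  rewrite Cmod_mult, Cmod_CpowZ by exact Hz. apply Rmult_1_r.
Qed.

(** On the circle the terms have the moduli of the coefficients, so the truncation error is at most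
    [eps] uniformly in [z]. The polynomial estimate then gives the bound [M + eps]. *)
Lemma laurent_coef_bound (a : Z -> C) (M : R) :
  abs_summableZ a ->
  (forall z, circle z -> (Cmod (CSeriesZ (fun k => a k * CpowZ z (k - 1))%C) <= M)%R) ->
  forall k, (Cmod (a k) <= M)%R.
Proof.
  intros Ha HM k. apply le_epsilon. intros eps He.
  destruct (Series_tail_small _ (eps / 2) (proj1 Ha) ltac:(lra)) as [N1 HN1].
  destruct (Series_tail_small _ (eps / 2) (proj2 Ha) ltac:(lra)) as [N2 HN2].
  (* The summand [Z.abs_nat k] makes sure that index [k] survives the truncation. *)
  set (L := (N1 + N2 + Z.abs_nat k)%nat).
  specialize (HN1 L ltac:(lia)). specialize (HN2 L ltac:(lia)).
  replace k with (Z.of_nat (Z.to_nat (k + Z.of_nat (S L))) - Z.of_nat (S L))%Z by lia.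
  apply (poly_coef_bound (fun i => a (Z.of_nat i - Z.of_nat (S L))%Z) (S (L + L)));
    [|lia].
  intros z Hz. rewrite <- laurent_truncation by now apply circle_neq_0.
  rewrite Cmod_mult, Cmod_pow, Hz, pow1, Rmult_1_l.
  specialize (HM z Hz).
  destruct (laurent_terms_summable a z Hz Ha) as [T1 T2].
  unfold CSeriesZ in HM.
  set (u := fun n => a (Z.of_nat n) * CpowZ z (Z.of_nat n - 1)) in *.
  set (v := fun n => a (- Z.of_nat (S n))%Z * CpowZ z (- Z.of_nat (S n) - 1)) in *.
  pose proof (CSeries_tail u L T1) as B1. pose proof (CSeries_tail v L T2) as B2.
  rewrite (Series_ext _ (fun k => Cmod (a (Z.of_nat (S L + k))))) in B1
    by (intros i; unfold u; rewrite Cmod_mult, Cmod_CpowZ by exact Hz; apply Rmult_1_r).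
  rewrite (Series_ext _ (fun k => Cmod (a (- Z.of_nat (S (S L + k)))%Z))) in B2
    by (intros i; unfold v; rewrite Cmod_mult, Cmod_CpowZ by exact Hz; apply Rmult_1_r).
  replace (sum_n u L + sum_n v L)
    with (CSeries u + CSeries v + (- (CSeries u - sum_n u L) + - (CSeries v - sum_n v L)))
    by cring.
  eapply Rle_trans; [apply Cmod_triangle|]. apply Rplus_le_compat; [exact HM|].
  eapply Rle_trans; [apply Cmod_triangle|]. rewrite !Cmod_opp.
  pose proof (Rle_abs (Series (fun k => Cmod (a (Z.of_nat (S L + k)))))).
  pose proof (Rle_abs (Series (fun k => Cmod (a (- Z.of_nat (S (S L + k)))%Z)))).
  cbv beta in *. lra.
Qed.

Lemma CSeriesZ_minus (a b : Z -> C) : abs_summableZ a -> abs_summableZ b ->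
  abs_summableZ (fun k => a k - b k) /\
  CSeriesZ (fun k => a k - b k) = CSeriesZ a - CSeriesZ b.
Proof.
  intros [A1 A2] [B1 B2]. split.
  - split.
    + apply (abs_summable_le _ (fun n => Cmod (a (Z.of_nat n)) + Cmod (b (Z.of_nat n)))%R).
      * intros n. eapply Rle_trans; [apply Cmod_triangle|]. rewrite Cmod_opp. lra.
      * now apply (@ex_series_plus R_AbsRing R_NormedModule).
    + apply (abs_summable_le _ (fun n => Cmod (a (- Z.of_nat (S n))%Z) +
                                        Cmod (b (- Z.of_nat (S n))%Z))%R).
      * intros n. eapply Rle_trans; [apply Cmod_triangle|]. rewrite Cmod_opp. lra.
      * now apply (@ex_series_plus R_AbsRing R_NormedModule).
  - unfold CSeriesZ.
    rewrite (is_Cseries_unique _ _ (is_Cseries_minus _ _ _ _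
               (abs_summable_series _ A1) (abs_summable_series _ B1))).
    rewrite (is_Cseries_unique _ _ (is_Cseries_minus _ _ _ _
               (abs_summable_series _ A2) (abs_summable_series _ B2))).
    cring.
Qed.

(** Cauchy's estimate with [M = 0], applied to the difference of the two expansions. *)
Lemma laurent_expansion_unique (h : C -> C) (a b : Z -> C) (k : Z) :
  laurent_expansion h a -> laurent_expansion h b -> a k = b k.
Proof.
  intros [Ha Ea] [Hb Eb].
  destruct (CSeriesZ_minus a b Ha Hb) as [Hd _].
  assert (H : (Cmod (a k - b k) <= 0)%R).
  { apply (laurent_coef_bound (fun k => a k - b k) 0 Hd). intros z Hz.
    rewrite (CSeriesZ_ext _ (fun k => a k * CpowZ z (k - 1) - b k * CpowZ z (k - 1)))
      by (intros; cring).
    rewrite (proj2 (CSeriesZ_minus _ _ (laurent_terms_summable a z Hz Ha)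
                      (laurent_terms_summable b z Hz Hb))).
    rewrite <- (Ea z Hz), <- (Eb z Hz).
    replace (h z - h z) with (RtoC 0) by cring. rewrite Cmod_0. lra. }
  assert (E : a k - b k = 0).
  { apply Cmod_eq_0. apply Rle_antisym; [exact H|apply Cmod_ge_0]. }
  rewrite <- (Cplus_0_r (b k)), <- E. cring.
Qed.

Lemma laurent_coef_eq (h : C -> C) (a : Z -> C) (k : Z) :
  laurent_expansion h a -> laurent_coef h k = a k.
Proof.
  intros H. apply (@iota_unique C_AbsRing C_CompleteNormedModule).
  - intros y [b [Hb ->]]. now apply (laurent_expansion_unique h).
  - now exists a.
Qed.

(** * Derivatives relative to a disk *)

Definition disk (r : R) (z : C) : Prop := (Cmod z <= r)%R.

(** The quotient-free form admits [w = z]. The set [A] varies because derivatives on the closed unit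
    disk are compared with those on smaller disks, where power series are under control. *)
Definition has_deriv_in (A : C -> Prop) (f : C -> C) (z l : C) : Prop :=
  forall eps, (0 < eps)%R -> exists d, (0 < d)%R /\ forall w, A w ->
    (Cmod (w - z) < d)%R -> (Cmod (f w - f z - (w - z) * l) <= eps * Cmod (w - z))%R.

Lemma is_disk_derive_iff (f : C -> C) (z l : C) : closed_disk z ->
  is_disk_derive f z l <-> has_deriv_in closed_disk f z l.
Proof.
  intros Hz. split.
  - intros [_ H] eps He.
    destruct (H z) with (eps := mkposreal eps He) as [d Hd].
    { intros P HP. now apply filter_le_within. }
    exists d. split; [apply cond_pos|]. intros w Hw Hwz. exact (Hd w Hwz Hw).
  - intros H. split.
    + exact (@is_linear_scal_l C_AbsRing C_NormedModule l).
    + intros y Hy.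
      (* [filterdiff] quantifies over all limits [y] of the filter. The filter is proper because [z]
         itself lies in the closed disk, so [z] is its only limit. *)
      assert (FP : ProperFilter' (within closed_disk
                     (@locally (AbsRing_UniformSpace C_AbsRing) z))).
      { constructor; [|apply within_filter, (@filter_filter _ _ (@locally_filter (AbsRing_UniformSpace C_AbsRing) z))].
        intros HF. exact (locally_singleton _ _ HF Hz). }
      replace y with z.
      2:{ apply (@is_filter_lim_unique C_AbsRing (AbsRing_NormedModule C_AbsRing)
                   _ FP); [|exact Hy].
          intros P HP. now apply filter_le_within. }
      intros eps. destruct (H eps (cond_pos eps)) as [d [Hd HD]].
      exists (mkposreal d Hd). intros w Hwz Hw. exact (HD w Hw Hwz).
Qed.

Lemma has_deriv_in_subset (A B : C -> Prop) (f : C -> C) (z l : C) :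
  (forall w, B w -> A w) -> has_deriv_in A f z l -> has_deriv_in B f z l.
Proof.
  intros HAB H eps He. destruct (H eps He) as [d [Hd HD]].
  exists d. split; [exact Hd|]. intros w Hw. apply HD. auto.
Qed.

Lemma has_deriv_in_ext (A : C -> Prop) (f g : C -> C) (z l : C) :
  (forall w, A w -> f w = g w) -> A z -> has_deriv_in A f z l -> has_deriv_in A g z l.
Proof.
  intros E Hz H eps He. destruct (H eps He) as [d [Hd HD]].
  exists d. split; [exact Hd|]. intros w Hw. rewrite <- !E by assumption. now apply HD.
Qed.

(** Without nearby points a relative derivative would not be unique. Away from the centre the point
    is moved radially inwards, which also works on the boundary. *)
Lemma disk_not_isolated (r : R) (z : C) (d : R) : (0 < r)%R -> disk r z -> (0 < d)%R ->
  exists w, disk r w /\ w <> z /\ (Cmod (w - z) < d)%R.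
Proof.
  intros Hr Hz Hd. unfold disk in *. destruct (Ceq_dec z 0) as [->|Hz0].
  - set (t := Rmin r (d / 2)).
    assert (0 < t)%R by (apply Rmin_pos; lra).
    assert (t <= r)%R by apply Rmin_l. assert (t <= d / 2)%R by apply Rmin_r.
    exists (RtoC t).
    replace (RtoC t - 0) with (RtoC t) by ring. rewrite Cmod_R, Rabs_pos_eq by lra.
    split; [lra|]. split; [|lra]. intros E. injection E. lra.
  - pose proof (proj1 (Cmod_gt_0 z) Hz0) as Hm.
    set (t := Rmin 1 (d / (2 * Cmod z))).
    assert (0 < t)%R by (apply Rmin_pos; [lra|apply Rdiv_lt_0_compat; lra]).
    assert (t <= 1)%R by apply Rmin_l.
    assert (Ht : (t <= d / (2 * Cmod z))%R) by apply Rmin_r.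
    exists (RtoC (1 - t) * z).
    replace (RtoC (1 - t) * z - z) with (RtoC (- t) * z)
      by (rewrite RtoC_minus, RtoC_opp; ring).
    rewrite !Cmod_mult, !Cmod_R, Rabs_Ropp, !Rabs_pos_eq by lra.
    split; [nra|]. split.
    + intros E. assert (E' : RtoC t * z = 0).
      { transitivity (z - RtoC (1 - t) * z); [rewrite RtoC_minus; ring|].
        rewrite E. ring. }
      apply (Cmult_neq_0 (RtoC t) z); [|exact Hz0|exact E'].
      intros E2. injection E2. lra.
    + apply (Rmult_le_compat_r (Cmod z)) in Ht; [|lra].
      replace (d / (2 * Cmod z) * Cmod z)%R with (d / 2)%R in Ht by (field; lra). lra.
Qed.

Lemma has_deriv_in_disk_unique (r : R) (f : C -> C) (z l1 l2 : C) :
  (0 < r)%R -> disk r z ->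
  has_deriv_in (disk r) f z l1 -> has_deriv_in (disk r) f z l2 -> l1 = l2.
Proof.
  intros Hr Hz H1 H2.
  assert (H : (Cmod (l1 - l2) <= 0)%R).
  { apply le_epsilon. intros eps He. rewrite Rplus_0_l.
    destruct (H1 (eps / 2)%R ltac:(lra)) as [d1 [Hd1 D1]].
    destruct (H2 (eps / 2)%R ltac:(lra)) as [d2 [Hd2 D2]].
    destruct (disk_not_isolated r z (Rmin d1 d2) Hr Hz) as [w [Hw [Hne Hd]]];
      [now apply Rmin_pos|].
    specialize (D1 w Hw (Rlt_le_trans _ _ _ Hd (Rmin_l _ _))).
    specialize (D2 w Hw (Rlt_le_trans _ _ _ Hd (Rmin_r _ _))).
    assert (Hp : (0 < Cmod (w - z))%R).
    { apply Cmod_gt_0. intros E. apply Hne. rewrite <- (Cplus_0_r z), <- E. ring. }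
    apply (Rmult_le_reg_l (Cmod (w - z))); [exact Hp|]. rewrite <- Cmod_mult.
    replace ((w - z) * (l1 - l2)) with
      ((f w - f z - (w - z) * l2) + - (f w - f z - (w - z) * l1)) by ring.
    eapply Rle_trans; [apply Cmod_triangle|]. rewrite Cmod_opp. lra. }
  assert (E : l1 - l2 = 0) by (apply Cmod_eq_0, Rle_antisym; [exact H|apply Cmod_ge_0]).
  rewrite <- (Cplus_0_r l2), <- E. ring.
Qed.

Lemma disk_derive_eq (f : C -> C) (z l : C) : closed_disk z ->
  has_deriv_in closed_disk f z l -> disk_derive f z = l.
Proof.
  intros Hz H. apply (@iota_unique C_AbsRing C_CompleteNormedModule).
  - intros y Hy. apply is_disk_derive_iff in Hy; [|exact Hz].
    apply (has_deriv_in_disk_unique 1 f z); [lra|exact Hz|exact Hy|exact H].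
  - now apply is_disk_derive_iff.
Qed.

(** * Power series differentiated term by term up to the boundary *)

Definition PS (b : nat -> C) (z : C) : C := CSeries (fun n => b n * z ^ n).
Definition PS_deriv (b : nat -> C) (n : nat) : C := RtoC (INR n + 1) * b (S n).

Definition summable_at (b : nat -> C) (r : R) : Prop :=
  abs_summable (fun n => b n * RtoC r ^ n).

Lemma Cmod_term_le (b : nat -> C) (r : R) (z : C) (n : nat) : disk r z ->
  (Cmod (b n * z ^ n) <= Cmod (b n * RtoC r ^ n))%R.
Proof.
  intros Hz. unfold disk in Hz. pose proof (Cmod_ge_0 z).
  rewrite !Cmod_mult, !Cmod_pow, Cmod_R, Rabs_pos_eq by lra.
  apply Rmult_le_compat_l; [apply Cmod_ge_0|]. apply pow_incr. lra.
Qed.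

Lemma PS_summable (b : nat -> C) (r : R) (z : C) : disk r z -> summable_at b r ->
  abs_summable (fun n => b n * z ^ n).
Proof.
  intros Hz. apply abs_summable_le. intros n. now apply Cmod_term_le.
Qed.

(* [pow_quot z n w = (w^(n+1) - z^(n+1)) / (w - z)], continued by its limit at [w = z]. *)
Fixpoint pow_quot (z : C) (n : nat) (w : C) : C :=
  match n with
  | O => 1
  | S m => w * pow_quot z m w + z ^ S m
  end.

Lemma pow_quot_eq (z w : C) (n : nat) : (w - z) * pow_quot z n w = w ^ S n - z ^ S n.
Proof.
  induction n as [|n IH]; [simpl; ring|].
  change (pow_quot z (S n) w) with (w * pow_quot z n w + z ^ S n).
  transitivity (w * ((w - z) * pow_quot z n w) + (w - z) * z ^ S n); [ring|].
  rewrite IH. simpl. ring.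
Qed.

Lemma pow_quot_diag (z : C) (n : nat) : pow_quot z n z = RtoC (INR n + 1) * z ^ n.
Proof.
  induction n as [|n IH]; [simpl; rewrite RtoC_plus; ring|].
  change (pow_quot z (S n) z) with (z * pow_quot z n z + z ^ S n).
  rewrite IH, S_INR, !RtoC_plus. simpl. ring.
Qed.

Lemma Cmod_pow_quot (r : R) (z w : C) (n : nat) : disk r z -> disk r w ->
  (Cmod (pow_quot z n w) <= (INR n + 1) * r ^ n)%R.
Proof.
  intros Hz Hw. unfold disk in *. pose proof (Cmod_ge_0 z). pose proof (Cmod_ge_0 w).
  induction n as [|n IH]; [simpl; rewrite Cmod_1; lra|].
  change (pow_quot z (S n) w) with (w * pow_quot z n w + z ^ S n).
  eapply Rle_trans; [apply Cmod_triangle|]. rewrite Cmod_mult, Cmod_pow, S_INR.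
  assert (Cmod z ^ S n <= r ^ S n)%R by (apply pow_incr; lra).
  assert (Cmod w * Cmod (pow_quot z n w) <= r * ((INR n + 1) * r ^ n))%R.
  { apply Rmult_le_compat; [lra|apply Cmod_ge_0|lra|exact IH]. }
  simpl in *. lra.
Qed.

(** This supplies the limit of each single term as [w] tends to [z]. The constant may grow with [n],
    since uniformity over the terms comes from domination. *)
Lemma pow_quot_lipschitz (r : R) (z : C) (n : nat) : disk r z ->
  exists K, (0 <= K)%R /\ forall w, disk r w ->
    (Cmod (pow_quot z n w - pow_quot z n z) <= K * Cmod (w - z))%R.
Proof.
  intros Hz. unfold disk in *. pose proof (Cmod_ge_0 z).
  induction n as [|n [K [HK IH]]].
  - exists 0%R. split; [lra|]. intros w _. simpl.
    replace (1 - 1) with (RtoC 0) by ring. rewrite Cmod_0. lra.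
  - exists (r * K + Cmod (pow_quot z n z))%R.
    split; [pose proof (Cmod_ge_0 (pow_quot z n z)); nra|].
    intros w Hw. pose proof (Cmod_ge_0 w).
    change (pow_quot z (S n) ?w) with (w * pow_quot z n w + z ^ S n).
    replace (w * pow_quot z n w + z ^ S n - (z * pow_quot z n z + z ^ S n)) with
      (w * (pow_quot z n w - pow_quot z n z) + (w - z) * pow_quot z n z) by ring.
    eapply Rle_trans; [apply Cmod_triangle|]. rewrite !Cmod_mult, Rmult_plus_distr_r.
    apply Rplus_le_compat; [|lra]. rewrite Rmult_assoc.
    apply Rmult_le_compat; [lra|apply Cmod_ge_0|lra|now apply IH].
Qed.

(** The difference quotient is the series of [b (S n) * pow_quot z n w], dominated on the whole disk
    by the terms of the derived series at [r]; Tannery's theorem lets [w] tend to [z]. Only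
    summability at [r] enters, so points with [Cmod z = r] are covered, and [r = 1] yields [f'] on
    the circle. *)
Lemma PS_has_deriv (b : nat -> C) (r : R) (z : C) :
  summable_at b r -> summable_at (PS_deriv b) r -> disk r z ->
  has_deriv_in (disk r) (PS b) z (PS (PS_deriv b) z).
Proof.
  intros Hb Hd Hz.
  set (v := fun n => Cmod (PS_deriv b n * RtoC r ^ n)).
  assert (Hr : (0 <= r)%R) by (eapply Rle_trans; [apply Cmod_ge_0|exact Hz]).
  assert (Hv : forall w n, disk r w -> (Cmod (b (S n) * pow_quot z n w) <= v n)%R).
  { intros w n Hw. unfold v, PS_deriv. rewrite !Cmod_mult, Cmod_pow, !Cmod_R.
    pose proof (pos_INR n). rewrite !Rabs_pos_eq by lra.
    rewrite (Rmult_comm (INR n + 1)), Rmult_assoc.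
    apply Rmult_le_compat_l; [apply Cmod_ge_0|now apply Cmod_pow_quot]. }
  assert (Hquot : forall w, disk r w ->
    PS b w - PS b z = (w - z) * CSeries (fun n => b (S n) * pow_quot z n w)).
  { intros w Hw. symmetry. rewrite <- CSeries_scal.
    2:{ apply (abs_summable_le _ v); [intros n; now apply Hv|exact Hd]. }
    apply is_Cseries_unique.
    pose proof (is_Cseries_minus _ _ _ _
      (abs_summable_series _ (PS_summable b r w Hw Hb))
      (abs_summable_series _ (PS_summable b r z Hz Hb))) as H.
    apply is_Cseries_incr_1 in H. simpl in H.
    replace (b 0%nat * 1 - b 0%nat * 1) with (RtoC 0) in H by ring.
    replace (PS b w - PS b z) with
      (CSeries (fun n => b n * w ^ n) - CSeries (fun n => b n * z ^ n) - 0)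
      by (unfold PS; ring).
    revert H. apply is_Cseries_ext. intros n.
    replace ((w - z) * (b (S n) * pow_quot z n w))
      with (b (S n) * ((w - z) * pow_quot z n w)) by ring.
    rewrite pow_quot_eq. simpl. ring. }
  intros eps He.
  assert (HT : within (disk r) (@locally (AbsRing_UniformSpace C_AbsRing) z)
    (fun w => (Cmod (CSeries (fun n => (b (S n) * pow_quot z n w)%C) -
       CSeries (fun n => (b (S n) * pow_quot z n z)%C)) < eps)%R)).
  { apply (tannery _ (fun w n => b (S n) * pow_quot z n w) _ v Hd); [| | |exact He].
    - exists (mkposreal 1 Rlt_0_1). intros w _ Hw n. now apply Hv.
    - intros n. now apply Hv.
    - intros n e He'. destruct (pow_quot_lipschitz r z n Hz) as [K [HK HL]].
      pose proof (Cmod_ge_0 (b (S n))) as HB.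
      (* The added [1] keeps the divisor positive even if the coefficient or [K] is zero. *)
      assert (HKB : (0 < Cmod (b (S n)) * K + 1)%R) by nra.
      assert (Hdel : (0 < e / (Cmod (b (S n)) * K + 1))%R) by now apply Rdiv_lt_0_compat.
      exists (mkposreal _ Hdel). intros w Hwz Hw.
      change (Cmod (w - z) < e / (Cmod (b (S n)) * K + 1))%R in Hwz.
      replace (b (S n) * pow_quot z n w - b (S n) * pow_quot z n z)
        with (b (S n) * (pow_quot z n w - pow_quot z n z)) by ring.
      rewrite Cmod_mult. specialize (HL w Hw).
      apply Rle_lt_trans with (Cmod (b (S n)) * K * Cmod (w - z))%R.
      { rewrite Rmult_assoc. now apply Rmult_le_compat_l. }
      apply (Rmult_lt_compat_l _ _ _ HKB) in Hwz.
      replace ((Cmod (b (S n)) * K + 1) * (e / (Cmod (b (S n)) * K + 1)))%R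
        with e in Hwz by (field; lra).
      pose proof (Cmod_ge_0 (w - z)). lra. }
  destruct HT as [d HD]. exists d. split; [apply cond_pos|]. intros w Hw Hwz.
  specialize (HD w Hwz Hw). cbv beta in HD.
  rewrite (Hquot w Hw).
  replace (PS (PS_deriv b) z) with (CSeries (fun n => b (S n) * pow_quot z n z)).
  2:{ apply CSeries_ext. intros n. rewrite pow_quot_diag. unfold PS_deriv. ring. }
  match goal with |- (Cmod (?a * ?s - ?a * ?t) <= _)%R =>
    replace (a * s - a * t) with (a * (s - t)) by ring end.
  rewrite Cmod_mult, Rmult_comm. apply Rmult_le_compat_r; [apply Cmod_ge_0|].
  now left.
Qed.

(** * Coefficient decay *)

Definition converges_in_disk (b : nat -> C) : Prop :=
  forall r, (0 <= r < 1)%R -> summable_at b r.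

(** Were the radius some [q < 1], the terms at [(q + 1) / 2], strictly between [q] and [1], could
    not tend to [0], whereas the terms of a convergent series do. Passing to moduli makes the theory
    of real power series available and upgrades convergence to absolute convergence. *)
Lemma CV_radius_ge_1 (b : nat -> C) :
  (forall r, (0 <= r < 1)%R -> exists s, is_Cseries (fun n => b n * RtoC r ^ n) s) ->
  Rbar_le 1 (CV_radius (fun n => Cmod (b n))).
Proof.
  intros H. apply Rbar_not_lt_le. intros Hlt.
  pose proof (CV_radius_ge_0 (fun n => Cmod (b n))) as H0.
  destruct (CV_radius (fun n => Cmod (b n))) as [q| |] eqn:E; simpl in *; try easy.
  assert (Hr : (0 <= (q + 1) / 2 < 1)%R) by lra.
  destruct (H _ Hr) as [s Hs].
  apply (CV_disk_outside (fun n => Cmod (b n)) ((q + 1) / 2)).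
  { rewrite E. simpl. rewrite Rabs_pos_eq; lra. }
  apply (is_lim_seq_ext (fun n => Cmod (b n * RtoC ((q + 1) / 2) ^ n))).
  { intros n. rewrite Cmod_mult, Cmod_pow, Cmod_R, Rabs_pos_eq by lra. reflexivity. }
  set (u := fun n => b n * RtoC ((q + 1) / 2) ^ n) in *.
  apply is_lim_seq_spec. intros eps.
  pose proof (cond_pos eps) as He.
  assert (He2 : (0 < eps / 2)%R) by lra.
  destruct (proj1 (@filterlim_locally_ball_norm C_AbsRing nat C_NormedModule
              eventually _ _ _) Hs (mkposreal _ He2)) as [N HN].
  exists (S N). intros [|n] Hn; [lia|].
  pose proof (HN n ltac:(lia)) as A1. pose proof (HN (S n) ltac:(lia)) as A2.
  change (Cmod (sum_n u n - s) < eps / 2)%R in A1.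
  change (Cmod (sum_n u (S n) - s) < eps / 2)%R in A2.
  rewrite sum_Sn in A2. change (plus ?a ?b) with (a + b) in A2.
  rewrite Rminus_0_r, Rabs_pos_eq by apply Cmod_ge_0.
  change (b (S n) * RtoC ((q + 1) / 2) ^ S n) with (u (S n)).
  replace (u (S n)) with ((sum_n u n + u (S n) - s) + - (sum_n u n - s)) by cring.
  eapply Rle_lt_trans; [apply Cmod_triangle|]. rewrite Cmod_opp. lra.
Qed.

Lemma CV_radius_ge_1_iff (b : nat -> C) :
  Rbar_le 1 (CV_radius (fun n => Cmod (b n))) <-> converges_in_disk b.
Proof.
  split.
  - intros H r Hr.
    apply (ex_series_ext (fun n => Rabs (Cmod (b n) * r ^ n))).
    + intros n. rewrite Cmod_mult, Cmod_pow, Cmod_R, Rabs_mult, <- RPow_abs.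
      f_equal. apply Rabs_pos_eq, Cmod_ge_0.
    + apply CV_disk_inside. apply Rbar_lt_le_trans with 1%R; [|exact H].
      simpl. rewrite Rabs_pos_eq; apply Hr.
  - intros H. apply CV_radius_ge_1. intros r Hr.
    exists (CSeries (fun n => b n * RtoC r ^ n)). now apply abs_summable_series, H.
Qed.

Lemma converges_in_disk_deriv (b : nat -> C) :
  converges_in_disk b -> converges_in_disk (PS_deriv b).
Proof.
  intros H. apply CV_radius_ge_1_iff. apply CV_radius_ge_1_iff in H.
  rewrite <- CV_radius_derive in H.
  rewrite (CV_radius_ext _ (PS_derive (fun n => Cmod (b n)))); [exact H|].
  intros n. unfold PS_deriv, PS_derive. rewrite Cmod_mult, Cmod_R, S_INR.
  rewrite Rabs_pos_eq; [reflexivity|]. pose proof (pos_INR n). lra.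
Qed.

(** On the disk of radius halfway between [Cmod z] and [1], both candidates are relative derivatives
    of the same function, so they agree. *)
Lemma disk_deriv_of_PS (f : C -> C) (b : nat -> C) (f' : C -> C) :
  converges_in_disk b ->
  (forall z, open_disk z -> f z = PS b z) ->
  (forall z, closed_disk z -> is_disk_derive f z (f' z)) ->
  forall z, open_disk z -> f' z = PS (PS_deriv b) z.
Proof.
  intros Hb Hf Hf' z Hz. unfold open_disk in *. pose proof (Cmod_ge_0 z).
  set (r := ((Cmod z + 1) / 2)%R).
  assert (Hr : (0 <= r < 1)%R) by (unfold r; lra).
  assert (Hzr : disk r z) by (unfold disk, r; lra).
  apply (has_deriv_in_disk_unique r (PS b) z); [unfold r; lra|exact Hzr| |].
  - apply (has_deriv_in_ext _ f); [|exact Hzr|].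
    + intros w Hw. apply Hf. unfold disk in Hw. lra.
    + apply (has_deriv_in_subset closed_disk).
      * intros w Hw. unfold disk, closed_disk in *. lra.
      * apply is_disk_derive_iff; [unfold closed_disk; lra|].
        apply Hf'. unfold closed_disk. lra.
  - apply PS_has_deriv; [apply Hb, Hr|apply converges_in_disk_deriv; assumption|exact Hzr].
Qed.

Lemma has_deriv_in_locally_bounded (A : C -> Prop) (f : C -> C) (z l : C) :
  has_deriv_in A f z l ->
  exists d M, (0 < d)%R /\ forall w, A w -> (Cmod (w - z) < d)%R -> (Cmod (f w) <= M)%R.
Proof.
  intros H. destruct (H 1%R Rlt_0_1) as [d [Hd HD]].
  exists d, (Cmod (f z) + d * Cmod l + d)%R. split; [exact Hd|].
  intros w Hw Hwz. specialize (HD w Hw Hwz).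
  replace (f w) with (f z + (w - z) * l + (f w - f z - (w - z) * l)) by ring.
  eapply Rle_trans; [apply Cmod_triangle|]. apply Rplus_le_compat; [|lra].
  eapply Rle_trans; [apply Cmod_triangle|]. apply Rplus_le_compat_l.
  rewrite Cmod_mult. apply Rmult_le_compat_r; [apply Cmod_ge_0|lra].
Qed.

(** Compactness of the square with sides from [-1] to [1], which contains the disk: finitely many of
    the local bounds suffice. *)
Lemma bounded_on_closed_disk (f : C -> C) :
  (forall z, closed_disk z -> exists d M, (0 < d)%R /\
     forall w, closed_disk w -> (Cmod (w - z) < d)%R -> (Cmod (f w) <= M)%R) ->
  exists M, forall z, closed_disk z -> (Cmod (f z) <= M)%R.
Proof.
  intros H.
  (* The cover consists of boxes in the maximum norm. A box of half-side [d] lies in the Euclidean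
     ball of radius [sqrt 2 * d], hence the factor [2]. *)
  assert (H' : forall z, exists p : posreal * R,
     forall w, closed_disk w -> (Cmod (w - z) < 2 * fst p)%R -> (Cmod (f w) <= snd p)%R).
  { intros z. destruct (Rle_lt_dec (Cmod z) 1) as [Hz|Hz].
    - destruct (H z Hz) as [d [M [Hd HM]]].
      assert (Hd2 : (0 < d / 2)%R) by lra.
      exists (mkposreal _ Hd2, M). simpl. intros w Hw Hwz. apply HM; [exact Hw|lra].
    (* The corners of the square lie outside the disk. Around such a point the ball of radius
       [Cmod z - 1] misses the closed disk, so any bound will do. *)
    - assert (Hd2 : (0 < (Cmod z - 1) / 2)%R) by lra.
      exists (mkposreal _ Hd2, 0%R). simpl. intros w Hw Hwz. exfalso.
      unfold closed_disk in Hw.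
      assert (Cmod z <= Cmod w + Cmod (w - z))%R; [|lra].
      replace z with (w + - (w - z)) at 1 by ring.
      eapply Rle_trans; [apply Cmod_triangle|]. rewrite Cmod_opp. lra. }
  destruct (functional_choice _ H') as [p Hp].
  pose (pt := fun t : Compactness.Tn 2 R => (fst t, fst (snd t)) : C).
  (* [compactness_list] provides the finite cover under a double negation only. *)
  apply NNPP. intros Hno.
  apply (compactness_list 2 ((-1)%R, ((-1)%R, tt)) (1%R, (1%R, tt))
           (fun t => fst (p (pt t)))).
  intros [l Hl]. apply Hno.
  assert (HM : exists M, forall t, In t l -> (snd (p (pt t)) <= M)%R).
  { clear. induction l as [|t l [M IH]]; [now exists 0%R|].
    exists (Rmax (snd (p (pt t))) M). intros s [->|Hs]; [apply Rmax_l|].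
    eapply Rle_trans; [now apply IH|apply Rmax_r]. }
  destruct HM as [M HM]. exists M. intros z Hz.
  pose proof (Rmax_Cmod z) as Hmax. unfold closed_disk in Hz.
  pose proof (Rmax_l (Rabs (fst z)) (Rabs (snd z))) as Hm1.
  pose proof (Rmax_r (Rabs (fst z)) (Rabs (snd z))) as Hm2.
  destruct (Hl (fst z, (snd z, tt))) as [t [Ht [_ Hc]]].
  { simpl. split; [|split; [|exact I]]; apply Rabs_le_between; lra. }
  eapply Rle_trans; [|apply (HM t Ht)]. apply Hp; [exact Hz|].
  destruct t as [t1 [t2 []]]. unfold pt in *. simpl in *. destruct Hc as [Hc1 [Hc2 _]].
  eapply Rle_lt_trans; [apply Cmod_2Rmax|]. simpl.
  set (d := pos (fst (p (t1, t2)))) in *.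
  assert (Rmax (Rabs (fst z + - t1)) (Rabs (snd z + - t2)) < d)%R
    by (apply Rmax_lub_lt; assumption).
  assert (Hs : (sqrt 2 < 2)%R).
  { rewrite <- (sqrt_square 2) at 2 by lra. apply sqrt_lt_1; lra. }
  pose proof (sqrt_pos 2).
  assert (0 <= Rmax (Rabs (fst z + - t1)) (Rabs (snd z + - t2)))%R
    by (eapply Rle_trans; [apply Rabs_pos|apply Rmax_l]).
  nra.
Qed.

Lemma PS_coef_bound (e : nat -> C) (r M : R) : (0 <= r)%R -> summable_at e r ->
  (forall z, Cmod z = r -> (Cmod (PS e z) <= M)%R) ->
  forall k, (Cmod (e k) * r ^ k <= M)%R.
Proof.
  intros Hr He HM k.
  (* The Laurent coefficients of [PS e (r * z)] as a function on the unit circle. Index [l] carries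
     the exponent [l - 1], so [e n] sits at [n + 1]. *)
  set (a := fun l : Z => if (1 <=? l)%Z
      then e (Z.to_nat (l - 1)) * RtoC r ^ Z.to_nat (l - 1) else RtoC 0).
  assert (Ea : forall n, a (Z.of_nat (S n)) = e n * RtoC r ^ n).
  { intros n. unfold a. replace (1 <=? Z.of_nat (S n))%Z with true
      by (symmetry; apply Z.leb_le; lia).
    now replace (Z.to_nat (Z.of_nat (S n) - 1)) with n by lia. }
  assert (En : forall n, a (- Z.of_nat (S n))%Z = 0).
  { intros n. unfold a. now replace (1 <=? - Z.of_nat (S n))%Z with false
      by (symmetry; apply Z.leb_gt; lia). }
  assert (Ha : abs_summableZ a).
  { split.
    - apply ex_series_incr_1. revert He. apply ex_series_ext. intros n. now rewrite Ea.
    - exists 0%R. apply (is_series_ext (fun _ => 0%R)).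
      + intros n. rewrite En. symmetry. apply Cmod_0.
      + apply is_series_Reals. intros x Hx. exists O. intros n _.
        rewrite <- sum_n_Reals, sum_n_const, Rmult_0_r.
        unfold R_dist. rewrite Rminus_0_r, Rabs_R0. exact Hx. }
  replace (Cmod (e k) * r ^ k)%R with (Cmod (a (Z.of_nat (S k)))).
  2:{ rewrite Ea, Cmod_mult, Cmod_pow, Cmod_R, Rabs_pos_eq by exact Hr. reflexivity. }
  apply (laurent_coef_bound a M Ha). intros z Hz.
  assert (Hrz : Cmod (RtoC r * z) = r).
  { rewrite Cmod_mult, Hz, Cmod_R, Rabs_pos_eq by exact Hr. ring. }
  replace (CSeriesZ (fun k => a k * CpowZ z (k - 1))) with (PS e (RtoC r * z));
    [now apply HM|].
  unfold CSeriesZ.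
  destruct (laurent_terms_summable a z Hz Ha) as [T1 T2].
  pose proof (is_Cseries_incr_1 _ _ (abs_summable_series _ T1)) as P1.
  assert (P1' : is_Cseries (fun n => e n * (RtoC r * z) ^ n)
     (CSeries (fun n => a (Z.of_nat n) * CpowZ z (Z.of_nat n - 1)))).
  { replace (CSeries (fun n => a (Z.of_nat n) * CpowZ z (Z.of_nat n - 1))) with
      (CSeries (fun n => a (Z.of_nat n) * CpowZ z (Z.of_nat n - 1)) -
       a (Z.of_nat 0) * CpowZ z (Z.of_nat 0 - 1)).
    - revert P1. apply is_Cseries_ext. intros n. rewrite Ea.
      replace (Z.of_nat (S n) - 1)%Z with (Z.of_nat n) by lia.
      rewrite CpowZ_of_nat, Cpow_mult_l. ring.
    - replace (a (Z.of_nat 0)) with (RtoC 0) by reflexivity. ring. }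
  rewrite <- (is_Cseries_unique _ _ P1').
  assert (P2 : is_Cseries
     (fun n => a (- Z.of_nat (S n))%Z * CpowZ z (- Z.of_nat (S n) - 1)) 0).
  { pose proof (is_Cseries_scal 0 _ _ (abs_summable_series _ T2)) as P0.
    rewrite Cmult_0_l in P0. revert P0. apply is_Cseries_ext. intros n. rewrite En. ring. }
  rewrite (is_Cseries_unique _ _ P2). unfold PS. ring.
Qed.

(** The limit [r -> 1] in Cauchy's estimate, by continuity of [x * r ^ k] at [1]. *)
Lemma Rle_of_mul_pow_le (x M : R) (k : nat) :
  (forall r, (0 < r < 1)%R -> (x * r ^ k <= M)%R) -> (x <= M)%R.
Proof.
  intros H. apply Rnot_lt_le. intros Hlt.
  assert (Hc : continuous (fun r => x * r ^ k)%R 1%R).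
  { apply (@ex_derive_continuous R_AbsRing R_NormedModule). auto_derive. exact I. }
  destruct (Hc (fun y => M < y)%R) as [d Hd].
  { apply open_gt. now rewrite pow1, Rmult_1_r. }
  set (t := Rmin (d / 2) (1 / 2)).
  pose proof (cond_pos d).
  assert (0 < t)%R by (apply Rmin_pos; lra).
  assert (t <= d / 2)%R by apply Rmin_l. assert (t <= 1 / 2)%R by apply Rmin_r.
  assert (HM : (M < x * (1 - t) ^ k)%R).
  { apply Hd. change (Rabs (1 - t - 1) < d)%R.
    replace (1 - t - 1)%R with (- t)%R by ring. rewrite Rabs_Ropp, Rabs_pos_eq; lra. }
  specialize (H (1 - t)%R ltac:(lra)). lra.
Qed.

Lemma PS_coef_bound_open_disk (e : nat -> C) (M : R) : converges_in_disk e ->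
  (forall z, open_disk z -> (Cmod (PS e z) <= M)%R) -> forall k, (Cmod (e k) <= M)%R.
Proof.
  intros He HM k. apply (Rle_of_mul_pow_le _ _ k). intros r Hr.
  apply PS_coef_bound; [lra|apply He; lra|]. intros z Hz. apply HM.
  unfold open_disk. lra.
Qed.

(** [fcoef], [f_taylor] and [dcoef] are the Taylor coefficients at [0] of [f(z)/z], of [f] and of
    [f']. The value [1] at index [0] is the normalisation of [f]. *)
Definition fcoef (x : coords) (n : nat) : C :=
  match n with O => RtoC 1 | S _ => c x n end.

Definition f_taylor (x : coords) (n : nat) : C :=
  match n with O => RtoC 0 | S m => fcoef x m end.

Definition dcoef (x : coords) (n : nat) : C := RtoC (INR n + 1) * fcoef x n.

Lemma f_of_PS (x : coords) (z s : C) :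
  is_Cseries (fun i => c x (S i) * z ^ S i) s ->
  is_Cseries (fun n => f_taylor x n * z ^ n) (f_of x z).
Proof.
  intros H. unfold f_of. rewrite (is_Cseries_unique _ _ H).
  replace (z * (1 + s)) with (f_taylor x 0 * z ^ 0 + z * (1 + s)) by (simpl; ring).
  apply (is_Cseries_decr_1 (fun n => f_taylor x n * z ^ n)).
  apply (is_Cseries_ext (fun n => z * (fcoef x n * z ^ n))); [intros n; simpl; ring|].
  apply is_Cseries_scal.
  replace (1 + s) with (fcoef x 0 * z ^ 0 + s) by (simpl; ring).
  apply (is_Cseries_decr_1 (fun n => fcoef x n * z ^ n)). exact H.
Qed.

(** Coefficient [n] of the third derivative is [(n+1)(n+2)(n+3)] times [fcoef x (n+2)], and Cauchy's
    estimate bounds it by the supremum of that derivative. *)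
Lemma fcoef_decay (x : coords) : phase_space x ->
  exists B, forall n, (Cmod (fcoef x n) * (INR n + 1) ^ 3 <= B)%R.
Proof.
  intros hx. destruct (f_smooth x hx) as [D [D0 DS]].
  assert (HPS : forall z, open_disk z ->
            is_Cseries (fun n => f_taylor x n * z ^ n) (f_of x z)).
  { intros z Hz. destruct (f_converges x hx z Hz) as [s Hs]. now apply (f_of_PS x z s). }
  assert (Hconv : converges_in_disk (f_taylor x)).
  { apply CV_radius_ge_1_iff, CV_radius_ge_1. intros r Hr. exists (f_of x (RtoC r)).
    apply HPS. unfold open_disk. rewrite Cmod_R, Rabs_pos_eq; lra. }
  set (b := fun k => Nat.iter k PS_deriv (f_taylor x)).
  assert (Hb : forall k, converges_in_disk (b k) /\
                         forall z, open_disk z -> D k z = PS (b k) z).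
  { induction k as [|k [IH1 IH2]].
    - split; [exact Hconv|]. intros z Hz. rewrite D0 by (unfold closed_disk, open_disk in *; lra).
      symmetry. now apply is_Cseries_unique, HPS.
    - split; [now apply converges_in_disk_deriv|].
      apply (disk_deriv_of_PS (D k)); [exact IH1|exact IH2|apply DS]. }
  (* The existence of [D 4] makes [D 3] locally bounded at every point of the closed disk, boundary
     included. *)
  destruct (bounded_on_closed_disk (D 3%nat)) as [M HM].
  { intros z Hz. apply (has_deriv_in_locally_bounded _ _ z (D 4%nat z)).
    apply is_disk_derive_iff; [exact Hz|now apply DS]. }
  destruct (Hb 3%nat) as [C3 E3].
  assert (HB : forall k, (Cmod (b 3%nat k) <= M)%R).
  { apply PS_coef_bound_open_disk; [exact C3|]. intros z Hz. rewrite <- E3 by exact Hz.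
    apply HM. unfold closed_disk, open_disk in *. lra. }
  assert (HM0 : (0 <= M)%R) by (eapply Rle_trans; [apply Cmod_ge_0|apply (HB O)]).
  (* The summands cover [n = 0], then [n = 1] with [(1+1)^3 = 8], then all larger indices, where
     [(t+3)^3 <= 5 (t+1)(t+2)(t+3)]; at [t = 0] this reads [27 <= 30]. *)
  exists (1 + 8 * Cmod (c x 1) + 5 * M)%R. intros n.
  pose proof (Cmod_ge_0 (c x 1)).
  destruct n as [|[|n]].
  - simpl. rewrite Cmod_1. lra.
  - simpl. lra.
  - specialize (HB n). unfold b in HB. simpl in HB. unfold PS_deriv in HB.
    change (f_taylor x (S (S (S n)))) with (fcoef x (S (S n))) in HB.
    rewrite !Cmod_mult, !Cmod_R in HB. rewrite !S_INR in *.
    pose proof (pos_INR n) as Hn. rewrite !Rabs_pos_eq in HB by lra.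
    set (y := Cmod (fcoef x (S (S n)))) in *.
    assert (Hy : (0 <= y)%R) by apply Cmod_ge_0.
    set (t := INR n) in *.
    assert (Hpoly : ((t + 1 + 1 + 1) ^ 3 <=
                     5 * ((t + 1) * ((t + 1 + 1) * (t + 1 + 1 + 1))))%R) by nra.
    apply Rle_trans with (5 * ((t + 1) * ((t + 1 + 1) * ((t + 1 + 1 + 1) * y))))%R; [|lra].
    apply (Rmult_le_compat_l y _ _ Hy) in Hpoly. lra.
Qed.

Lemma ex_series_inv_square : ex_series (fun n => / (INR n + 1) ^ 2)%R.
Proof.
  apply (ex_series_bounded _ 2).
  - intros k. pose proof (pos_INR k). left. apply Rinv_0_lt_compat, pow_lt. lra.
  - intros n.
    (* The correction [- / (INR n + 1)] makes the induction telescope. *)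
    assert (H : (sum_n (fun n => / (INR n + 1) ^ 2)%R n <= 2 - / (INR n + 1))%R).
    { induction n as [|n IH].
      - rewrite sum_O. simpl. replace (/ ((0 + 1) * ((0 + 1) * 1)))%R with 1%R by field.
        replace (/ (0 + 1))%R with 1%R by field. lra.
      - rewrite sum_Sn, S_INR. change (plus ?a ?b) with (a + b)%R.
        pose proof (pos_INR n). set (t := INR n) in *.
        assert (/ (t + 1 + 1) ^ 2 <= / (t + 1) - / (t + 1 + 1))%R; [|lra].
        replace (/ (t + 1) - / (t + 1 + 1))%R with (/ ((t + 1) * (t + 1 + 1)))%R
          by (field; lra).
        apply Rinv_le_contravar; nra. }
    pose proof (pos_INR n).
    assert (0 < / (INR n + 1))%R by (apply Rinv_0_lt_compat; lra). lra.
Qed.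

(** * The functionals [Gbar k] and their brackets *)

(** Both conditions are insensitive to a change of one coordinate, so formulas proved under them may
    be differentiated along any coordinate. *)
Definition regular (x : coords) : Prop :=
  abs_summable (dcoef x) /\ abs_summableZ (psib x).

Definition gcoef (x : coords) (k : Z) : C :=
  CSeries (fun j => dcoef x j * psib x (k + Z.of_nat j)%Z).

Lemma abs_summable_mul_bounded (u v : nat -> C) (B : R) :
  abs_summable u -> (forall n, (Cmod (v n) <= B)%R) -> abs_summable (fun n => v n * u n).
Proof.
  intros Hu Hv. apply (abs_summable_le _ (fun n => B * Cmod (u n))%R).
  - intros n. rewrite Cmod_mult. apply Rmult_le_compat_r; [apply Cmod_ge_0|apply Hv].
  - exact (@ex_series_scal R_AbsRing R_NormedModule B _ Hu).
Qed.

Lemma abs_summableZ_bounded (a : Z -> C) :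
  abs_summableZ a -> forall k, (Cmod (a k) <= normZ a)%R.
Proof.
  intros Ha.
  assert (H : forall (u : nat -> C) B,
    (forall M, (sum_n (fun n => Cmod (u n)) M <= B)%R) -> forall n, (Cmod (u n) <= B)%R).
  { intros u B HB n. eapply Rle_trans; [|apply (HB n)].
    destruct n as [|n]; [rewrite sum_O; apply Rle_refl|]. rewrite sum_Sn.
    change (plus ?a ?b) with (a + b)%R.
    pose proof (Cmod_sum_n u n). pose proof (Cmod_ge_0 (sum_n u n)). lra. }
  destruct (halves_le_normZ a Ha) as [H1 H2]. intros k.
  destruct (Z_le_dec 0 k).
  - replace k with (Z.of_nat (Z.to_nat k)) by lia. now apply (H (fun n => a (Z.of_nat n))).
  - replace k with (- Z.of_nat (S (Z.to_nat (- k - 1))))%Z by lia.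
    now apply (H (fun n => a (- Z.of_nat (S n))%Z)).
Qed.

Lemma gcoef_summable (x : coords) (k : Z) : regular x ->
  abs_summable (fun j => dcoef x j * psib x (k + Z.of_nat j)%Z).
Proof.
  intros [Hd Hp].
  apply (ex_series_ext (fun j => Cmod (psib x (k + Z.of_nat j)%Z * dcoef x j))).
  { intros j. now rewrite Cmult_comm. }
  apply (abs_summable_mul_bounded _ (fun j => psib x (k + Z.of_nat j)%Z) (normZ (psib x)));
    [exact Hd|].
  intros n. now apply abs_summableZ_bounded.
Qed.

(** Summability of [dcoef x] permits termwise differentiation at radius [1]. Thus boundary values of
    [f'] are also available at the perturbed points, where smoothness of [f] is not given. *)
Lemma disk_derive_f_of (x : coords) (z : C) : abs_summable (dcoef x) -> circle z ->
  disk_derive (f_of x) z = PS (dcoef x) z.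
Proof.
  intros Hd Hz.
  assert (Hf : forall n, (Cmod (fcoef x n) <= Cmod (dcoef x n))%R).
  { intros n. unfold dcoef. rewrite Cmod_mult, Cmod_R. pose proof (pos_INR n).
    rewrite Rabs_pos_eq by lra. pose proof (Cmod_ge_0 (fcoef x n)). nra. }
  assert (Hft : abs_summable (f_taylor x))
    by (apply ex_series_incr_1; now apply (abs_summable_le (fcoef x) _ Hf)).
  assert (H1 : forall b, abs_summable b -> summable_at b 1).
  { intros b. apply ex_series_ext. intros n. now rewrite Cpow_1_l, Cmult_1_r. }
  apply disk_derive_eq; [unfold closed_disk; rewrite Hz; lra|].
  apply (has_deriv_in_ext _ (PS (f_taylor x))).
  - intros w Hw. apply is_Cseries_unique. eapply f_of_PS.
    apply (is_Cseries_incr_1 (fun n => fcoef x n * w ^ n)), abs_summable_series.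
    apply (PS_summable _ 1); [exact Hw|]. apply H1.
    now apply (abs_summable_le (fcoef x) _ Hf).
  - unfold closed_disk. rewrite Hz. lra.
  - apply PS_has_deriv; [now apply H1|now apply H1|].
    unfold disk. rewrite Hz. lra.
Qed.

Lemma Cconj_mul_circle (z : C) : circle z -> Cconj z * z = 1.
Proof.
  intros Hz. rewrite Cmult_comm, <- Cmod2_conj, Hz. now rewrite pow1.
Qed.

(** On the circle [Cconj z ^ j] cancels [z ^ j], so the terms of conjugated [f'] times [psi] that
    carry [z^(k-1)] are exactly those of a correlation. *)
Lemma gen_G_laurent (x : coords) : regular x ->
  laurent_expansion (gen_G x) (fun k => Cconj (gcoef x k)).
Proof.
  intros Hx. pose proof Hx as [Hd Hp].
  set (qz := fun (z : C) (k : Z) => Cconj (psib x k) * CpowZ z (k - 1)).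
  set (bz := fun (z : C) (j : nat) => Cconj (dcoef x j * z ^ j)).
  assert (Hq : forall z, circle z -> abs_summableZ (qz z)).
  { intros z Hz. apply (laurent_terms_summable (fun k => Cconj (psib x k)) z Hz).
    revert Hp. apply abs_summableZ_Cmod_eq. intros k. apply Cmod_conj. }
  assert (Hb : forall z, circle z -> abs_summable (bz z)).
  { intros z Hz. revert Hd. apply ex_series_ext. intros n. unfold bz.
    rewrite Cmod_conj, Cmod_mult, Cmod_pow, Hz, pow1. now rewrite Rmult_1_r. }
  assert (Hc : forall z k, circle z ->
            corr (bz z) (qz z) k = Cconj (gcoef x k) * CpowZ z (k - 1)).
  { intros z k Hz. apply is_Cseries_unique.
    rewrite Cmult_comm.
    pose proof (is_Cseries_scal (CpowZ z (k - 1)) _ _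
      (is_Cseries_conj _ _ (abs_summable_series _ (gcoef_summable x k Hx)))) as H.
    revert H. apply is_Cseries_ext. intros j. unfold bz, qz.
    replace (k + Z.of_nat j - 1)%Z with (k - 1 + Z.of_nat j)%Z by lia.
    rewrite CpowZ_add_nat by now apply circle_neq_0.
    rewrite !Cmult_conj, Cpow_conj.
    transitivity (CpowZ z (k - 1) * (Cconj (dcoef x j) * Cconj (psib x (k + Z.of_nat j))) *
                  (Cconj z ^ j * z ^ j)).
    - rewrite <- Cpow_mult_l, Cconj_mul_circle, Cpow_1_l by exact Hz. ring.
    - ring. }
  split.
  (* The moduli of the terms do not depend on the point of the circle, so summability may be read
     off at [z = 1]. *)
  - assert (H1 : circle 1) by (unfold circle; apply Cmod_1).
    destruct (corr_CSeriesZ (bz 1) (qz 1) (Hb _ H1) (Hq _ H1)) as [S1 _].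
    revert S1. apply abs_summableZ_Cmod_eq. intros k.
    rewrite Hc by exact H1. rewrite Cmod_mult, Cmod_CpowZ by exact H1. ring.
  - intros z Hz.
    destruct (corr_CSeriesZ (bz z) (qz z) (Hb z Hz) (Hq z Hz)) as [_ E].
    rewrite <- (CSeriesZ_ext _ _ (fun k => Hc z k Hz)), E.
    unfold gen_G. rewrite Cmult_conj, Cconj_conj, disk_derive_f_of by assumption.
    f_equal. symmetry. apply is_Cseries_unique, is_Cseries_conj, abs_summable_series.
    apply (PS_summable _ 1); [unfold disk; rewrite Hz; lra|].
    revert Hd. apply ex_series_ext. intros n. now rewrite Cpow_1_l, Cmult_1_r.
Qed.

Lemma G_eq (x : coords) (k : Z) : regular x -> G k x = Cconj (gcoef x k).
Proof.
  intros Hx. unfold G. now rewrite (laurent_coef_eq _ _ k (gen_G_laurent x Hx)).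
Qed.

Lemma Gbar_eq (x : coords) (k : Z) : regular x -> Gbar k x = gcoef x k.
Proof. intros Hx. unfold Gbar. now rewrite G_eq, Cconj_conj. Qed.

Lemma Gbar_series (x : coords) (k : Z) : regular x ->
  is_Cseries (fun j => dcoef x j * psib x (k + Z.of_nat j)%Z) (Gbar k x).
Proof.
  intros Hx. rewrite Gbar_eq by exact Hx. now apply abs_summable_series, gcoef_summable.
Qed.

(** * Dependence on a single coordinate *)

Lemma abs_summable_update (u v : nat -> C) (k : nat) :
  (forall j, j <> k -> v j = u j) -> abs_summable u -> abs_summable v.
Proof.
  intros E Hu. apply (ex_series_incr_n _ (S k)).
  apply (ex_series_ext (fun j => Cmod (u (S k + j)%nat))).
  - intros j. now rewrite E by lia.
  - now apply (ex_series_incr_n (fun j => Cmod (u j)) (S k)).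
Qed.

Lemma CSeries_update (u v : nat -> C) (k : nat) :
  (forall j, j <> k -> v j = u j) -> abs_summable u ->
  CSeries v = CSeries u + (v k - u k).
Proof.
  intros E Hu. apply is_Cseries_unique.
  apply (is_Cseries_ext (fun j => u j + (v j - u j))); [intros; ring|].
  apply is_Cseries_plus; [now apply abs_summable_series|].
  (* The correction has a single nonzero term, so its partial sums are constant from [k] on. *)
  apply (filterlim_ext_loc (fun _ => v k - u k)); [|apply filterlim_const].
  exists k. intros n Hn. rewrite (sum_n_single _ k).
  - now destruct (le_dec k n).
  - intros i _ Hi. rewrite E by exact Hi. ring.
Qed.

Lemma dcoef_set_c (x : coords) (k j : nat) (t : C) :
  j <> k -> dcoef (set_c x k t) j = dcoef x j.
Proof.
  intros H. unfold dcoef. f_equal. destruct j as [|j]; [reflexivity|]. simpl.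
  destruct k as [|k]; [reflexivity|]. now replace (Nat.eqb j k) with false
    by (symmetry; apply Nat.eqb_neq; congruence).
Qed.

Lemma dcoef_set_c_same (x : coords) (k : nat) (t : C) : (1 <= k)%nat ->
  dcoef (set_c x k t) k = RtoC (INR k + 1) * t.
Proof.
  intros H. unfold dcoef. destruct k as [|k]; [lia|]. simpl. now rewrite Nat.eqb_refl.
Qed.

Lemma regular_set_c (x : coords) (k : nat) (t : C) : regular x -> regular (set_c x k t).
Proof.
  intros [Hd Hp]. split; [|exact Hp].
  revert Hd. apply (abs_summable_update _ _ k). intros j. apply dcoef_set_c.
Qed.

Lemma regular_set_psib (x : coords) (k : nat) (t : C) :
  regular x -> regular (set_psib x (Z.of_nat k) t).
Proof.
  intros [Hd [H1 H2]]. split; [exact Hd|]. split.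
  - revert H1.
    apply (abs_summable_update (fun n => psib x (Z.of_nat n)) _ k).
    intros j Hj. cbn [psib set_psib].
    now replace (Z.eqb (Z.of_nat j) (Z.of_nat k)) with false
      by (symmetry; apply Z.eqb_neq; lia).
  - revert H2. apply ex_series_ext. intros j. cbn [psib set_psib].
    now replace (Z.eqb (- Z.of_nat (S j)) (Z.of_nat k)) with false
      by (symmetry; apply Z.eqb_neq; lia).
Qed.

Lemma is_derive_affine (F : C -> C) (t0 l : C) :
  (forall t, F t = F t0 + (t - t0) * l) ->
  @is_derive C_AbsRing C_NormedModule F t0 l.
Proof.
  intros H. split; [exact (@is_linear_scal_l C_AbsRing C_NormedModule l)|].
  intros y Hy. apply (@is_filter_lim_locally_unique C_AbsRing) in Hy.
  intros eps. apply filter_forall. intros w. rewrite <- Hy.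
  change (Cmod (F w - F t0 - (w - t0) * l) <= eps * Cmod (w - t0))%R.
  replace (F w - F t0 - (w - t0) * l) with (RtoC 0) by (rewrite (H w); ring).
  rewrite Cmod_0. apply Rmult_le_pos; [left; apply cond_pos|apply Cmod_ge_0].
Qed.

Lemma Gbar_partial_c (x : coords) (m : Z) (k : nat) : regular x -> (1 <= k)%nat ->
  is_partial_c (Gbar m) k x (RtoC (INR k + 1) * psib x (m + Z.of_nat k)%Z).
Proof.
  intros Hx Hk. apply is_derive_affine. intros t.
  (* The closed formula is applied along the whole line of perturbed points. The base point appears
     there as [set_c x k (c x k)]. *)
  rewrite !Gbar_eq by now apply regular_set_c. unfold gcoef.
  rewrite (CSeries_update (fun j => dcoef (set_c x k (c x k)) j *
             psib (set_c x k (c x k)) (m + Z.of_nat j)) _ k).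
  - rewrite !dcoef_set_c_same by exact Hk. cbn [psib set_c]. ring.
  - intros j Hj. now rewrite !dcoef_set_c.
  - now apply gcoef_summable, regular_set_c.
Qed.

Lemma Gbar_partial_psib (x : coords) (m k : nat) : regular x ->
  is_partial_psib (Gbar (Z.of_nat m)) (Z.of_nat k) x
    (if Nat.leb m k then dcoef x (k - m) else 0).
Proof.
  intros Hx. apply is_derive_affine. intros t.
  rewrite !Gbar_eq by now apply regular_set_psib. unfold gcoef.
  destruct (Nat.leb_spec m k) as [H|H].
  - set (y := psib x (Z.of_nat k)).
    rewrite (CSeries_update (fun j => dcoef (set_psib x (Z.of_nat k) y) j *
               psib (set_psib x (Z.of_nat k) y) (Z.of_nat m + Z.of_nat j)) _ (k - m)).
    + cbn [psib set_psib].
      replace (Z.of_nat m + Z.of_nat (k - m))%Z with (Z.of_nat k) by lia.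
      rewrite Z.eqb_refl. change (dcoef (set_psib x (Z.of_nat k) ?s)) with (dcoef x). ring.
    + intros j Hj. cbn [psib set_psib].
      now replace (Z.eqb (Z.of_nat m + Z.of_nat j) (Z.of_nat k)) with false
        by (symmetry; apply Z.eqb_neq; lia).
    + now apply gcoef_summable, regular_set_psib.
  - rewrite Cmult_0_r, Cplus_0_r. apply CSeries_ext. intros j. cbn [psib set_psib].
    now replace (Z.eqb (Z.of_nat m + Z.of_nat j) (Z.of_nat k)) with false
      by (symmetry; apply Z.eqb_neq; lia).
Qed.

(** * Evaluation of the bracket *)

Lemma is_Cseries_shift (u : nat -> C) (s : C) (n : nat) : is_Cseries u s ->
  is_Cseries (fun i => if Nat.leb n i then u (i - n)%nat else 0) s.
Proof.
  intros H. induction n as [|n IH].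
  - revert H. apply is_Cseries_ext. intros i. simpl. f_equal. lia.
  - rewrite <- (Cplus_0_l s).
    apply (is_Cseries_decr_1 (fun i => if Nat.leb (S n) i then u (i - S n)%nat else 0)).
    exact IH.
Qed.

Lemma dcoef_decay (x : coords) : phase_space x ->
  exists B, forall n, (Cmod (dcoef x n) * (INR n + 1) ^ 2 <= B)%R.
Proof.
  intros hx. destruct (fcoef_decay x hx) as [B HB]. exists B. intros n.
  eapply Rle_trans; [|apply (HB n)]. unfold dcoef. rewrite Cmod_mult, Cmod_R.
  pose proof (pos_INR n). rewrite Rabs_pos_eq by lra. right. ring.
Qed.

Lemma phase_space_regular (x : coords) : phase_space x -> regular x.
Proof.
  intros hx. split.
  - destruct (dcoef_decay x hx) as [B HB].
    apply (abs_summable_le _ (fun n => B * / (INR n + 1) ^ 2)%R).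
    + intros n. pose proof (pos_INR n).
      assert (Hp : (0 < (INR n + 1) ^ 2)%R) by (apply pow_lt; lra).
      apply (Rmult_le_reg_r _ _ _ Hp). rewrite Rmult_assoc, Rinv_l by lra.
      rewrite Rmult_1_r. apply HB.
    + exact (@ex_series_scal R_AbsRing R_NormedModule B _ ex_series_inv_square).
  - generalize (proj1 (psi_expansion x hx)). apply abs_summableZ_Cmod_eq.
    intros k. symmetry. apply Cmod_conj.
Qed.

(** Convergence comes from the summability of [psib x]; the decay of the coefficients of [f] only
    has to keep the weighted factors bounded. *)
Lemma weighted_gcoef_summable (x : coords) (p : nat) : phase_space x ->
  abs_summable (fun j => RtoC (INR j + 1) * dcoef x j * psib x (Z.of_nat p + Z.of_nat j)%Z).
Proof.
  intros hx. destruct (dcoef_decay x hx) as [B HB].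
  apply (abs_summable_mul_bounded (fun j => psib x (Z.of_nat p + Z.of_nat j)%Z)
           (fun j => RtoC (INR j + 1) * dcoef x j) B).
  - destruct (abs_summableZ_shift _ p (proj2 (phase_space_regular x hx))) as [H _].
    revert H. apply ex_series_ext. intros j. do 2 f_equal. lia.
  - intros n. eapply Rle_trans; [|apply (HB n)]. rewrite Cmod_mult, Cmod_R.
    pose proof (pos_INR n). rewrite Rabs_pos_eq by lra.
    pose proof (Cmod_ge_0 (dcoef x n)). simpl. nra.
Qed.

Lemma Gbar_bracket (x : coords) (m n : nat) : phase_space x ->
  (1 <= m)%nat -> (1 <= n)%nat ->
  is_poisson_bracket (Gbar (Z.of_nat m)) (Gbar (Z.of_nat n)) x
    (RtoC (INR n - INR m) * Gbar (Z.of_nat (n + m)) x).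
Proof.
  intros hx Hm Hn. pose proof (phase_space_regular x hx) as Hx.
  set (dc := fun p k => RtoC (INR k + 1) * psib x (Z.of_nat p + Z.of_nat k)%Z).
  set (dp := fun p k => if Nat.leb p k then dcoef x (k - p) else RtoC 0).
  (* The part common to both halves. It depends on [n + m] only and cancels in the difference. *)
  set (W := CSeries (fun j => RtoC (INR j + 1) * dcoef x j *
                              psib x (Z.of_nat (n + m) + Z.of_nat j)%Z)).
  exists (dc m), (dp m), (dc n), (dp n). split.
  { intros k Hk. split; [|split; [|split]].
    - now apply Gbar_partial_c.
    - now apply Gbar_partial_psib.
    - now apply Gbar_partial_c.
    - now apply Gbar_partial_psib. }
  (* In each half of the bracket, substitute [k = j + q]. *)
  assert (Half : forall p q, (1 <= q)%nat -> (p + q = n + m)%nat ->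
    is_Cseries (fun i => dc p (S i) * dp q (S i))
      (W + RtoC (INR q) * Gbar (Z.of_nat (n + m)) x)).
  { intros p q Hq Hpq.
    pose proof (is_Cseries_plus _ _ _ _
      (abs_summable_series _ (weighted_gcoef_summable x (n + m) hx))
      (is_Cseries_scal (RtoC (INR q)) _ _ (Gbar_series x (Z.of_nat (n + m)) Hx))) as H.
    (* Position [i] of the bracket stands for [k = i + 1], and [dp q k] vanishes for [k < q]; so
       [q - 1] zeros precede and [j = i - (q - 1)]. The factor [k + 1] splits as [(j + 1) + q],
       which accounts for the two summands. *)
    apply (is_Cseries_shift _ _ (q - 1)) in H. revert H. apply is_Cseries_ext.
    intros i. unfold dc, dp.
    destruct (Nat.leb_spec (q - 1) i) as [Hi|Hi], (Nat.leb_spec q (S i)); try lia;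
      [|ring].
    replace (S i - q)%nat with (i - (q - 1))%nat by lia.
    replace (Z.of_nat p + Z.of_nat (S i))%Z
      with (Z.of_nat (n + m) + Z.of_nat (i - (q - 1)))%Z by lia.
    replace (INR (S i)) with (INR (i - (q - 1)) + INR q)%R
      by (rewrite <- plus_INR; f_equal; lia).
    rewrite !RtoC_plus. ring. }
  pose proof (is_Cseries_minus _ _ _ _ (Half m n Hn ltac:(lia)) (Half n m Hm ltac:(lia))) as H.
  replace (RtoC (INR n - INR m) * Gbar (Z.of_nat (n + m)) x) with
    (W + RtoC (INR n) * Gbar (Z.of_nat (n + m)) x -
     (W + RtoC (INR m) * Gbar (Z.of_nat (n + m)) x)) by (rewrite RtoC_minus; ring).
  revert H. apply is_Cseries_ext. intros i. ring.
Qed.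

Theorem proposition2 (x : coords) (hx : phase_space x) :
  laurent_expansion (gen_G x) (fun k => G k x) /\
  (forall k : Z, (1 <= k)%Z ->
     exists s : C,
       is_Cseries
         (fun i => RtoC (INR (S i) + 1) * c x (S i) * psib x (k + Z.of_nat (S i))%Z) s /\
       Gbar k x = psib x k + s) /\
  (forall m n : Z, (1 <= m)%Z -> (1 <= n)%Z ->
     is_poisson_bracket (Gbar m) (Gbar n) x (RtoC (IZR (n - m)) * Gbar (n + m) x)).
Proof.
  pose proof (phase_space_regular x hx) as Hx. split; [|split].
  - replace (fun k => G k x) with (fun k => Cconj (gcoef x k)).
    + now apply gen_G_laurent.
    + apply functional_extensionality. intros k. now rewrite G_eq.
  - intros k _. exists (Gbar k x - psib x k). split; [|ring].
    (* The term [j = 0], whose coefficient is [1], is split off as [psib x k]. *)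
    pose proof (is_Cseries_incr_1 _ _ (Gbar_series x k Hx)) as H. cbv beta in H.
    replace (Gbar k x - psib x k) with
      (Gbar k x - dcoef x 0 * psib x (k + Z.of_nat 0)%Z); [exact H|].
    rewrite Z.add_0_r. unfold dcoef. simpl. rewrite RtoC_plus. ring.
  - intros m n Hm Hn.
    replace (RtoC (IZR (n - m))) with (RtoC (INR (Z.to_nat n) - INR (Z.to_nat m))).
    + replace (n + m)%Z with (Z.of_nat (Z.to_nat n + Z.to_nat m)) by lia.
      rewrite <- (Z2Nat.id m), <- (Z2Nat.id n), !Nat2Z.id by lia.
      apply Gbar_bracket; [exact hx|lia|lia].
    + f_equal. rewrite !INR_IZR_INZ, <- minus_IZR. f_equal. lia.
Qed.
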